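(* Let $\mathcal{P}$ be an arbitrary set of prime numbers (finite or infinite), and let $\langle \mathcal{P} \rangle \subset \mathbb{N}$ denote the set of natural numbers all of whose prime factors lie in $\mathcal{P}$ (including $1$). Then the series $\sum_{n \in \langle \mathcal{P}\rangle} \frac{\mu(n)}{n}$ (summed in increasing order of $n$) converges to $\prod_{p \in \mathcal{P}} (1 - \frac{1}{p})$, i.e. $$\lim_{x \to \infty} \sum_{n \in \langle \mathcal{P} \rangle:\, n \leq x} \frac{\mu(n)}{n} = \prod_{p \in \mathcal{P}} \Big(1-\frac{1}{p}\Big),$$ where the infinite product is interpreted as $0$ when it diverges to zero. In particular, $\sum_{n \in \langle \mathcal{P}\rangle} \frac{\mu(n)}{n}$ converges to $0$ if and only if $\sum_{p \in \mathcal{P}} \frac{1}{p} = \infty$.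
   Context: $\mu$ denotes the Möbius function: $\mu(n) = (-1)^k$ if $n$ is a product of $k$ distinct primes, and $\mu(n)=0$ otherwise. The rate of convergence may depend on $\mathcal{P}$. *)

(* Defs.v *)
From HB Require Import structures.
From mathcomp Require Import all_boot all_order all_algebra.
From mathcomp Require Import all_classical all_reals all_analysis.
Set Implicit Arguments. Unset Strict Implicit. Unset Printing Implicit Defensive.
Import Order.TTheory GRing.Theory Num.Theory.
Local Open Scope ring_scope.

(* n is squarefree (n > 0 assumed where used) *)
Definition squarefreen (n : nat) : bool :=
  all (fun p => (logn p n <= 1)%N) (primes n).

Definition mobius (R : pzRingType) (n : nat) : R :=
  if (0 < n)%N && squarefreen n then (-1) ^+ size (primes n) else 0.

Definition Psmooth (P : pred nat) (n : nat) : bool :=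
  (0 < n)%N && all P (primes n).

Definition mobius_partial (R : realType) (P : pred nat) (N : nat) : R :=
  \sum_(0 <= n < N.+1 | Psmooth P n) mobius R n / n%:R.

Definition euler_partial (R : realType) (P : pred nat) (N : nat) : R :=
  \prod_(0 <= p < N.+1 | P p) (1 - (p%:R)^-1).

Definition recip_partial (R : realType) (P : pred nat) (N : nat) : R :=
  \sum_(0 <= p < N.+1 | P p) (p%:R)^-1.

(* Main.v *)
Require Import Defs.
From HB Require Import structures.
From mathcomp Require Import all_boot all_order all_algebra.
From mathcomp Require Import all_classical all_reals all_analysis.
From mathcomp Require Import ring lra zify.
Set Implicit Arguments. Unset Strict Implicit. Unset Printing Implicit Defensive.
Import Order.TTheory GRing.Theory Num.Theory numFieldNormedType.Exports.
Local Open Scope ring_scope.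
Local Open Scope classical_set_scope.

(* Write mu_P for mu restricted to <P> and M_P for its summatory function.  As
   mu_P * 1 is the indicator of the integers free of prime factors in P,
     x \sum_(n <= x) mu_P(n) / n =
       #{n <= x : no p in P divides n} + \sum_(n <= x) mu_P(n) {x / n}.
   The sieve of Eratosthenes-Legendre shows that the first term is
   x (\prod_(p in P) (1 - 1/p) + o(1)), and by Axer's theorem the second one is
   o(x) once M_P(x) = o(x).  Let Q be the set of primes outside P.  If
   \sum_(q in Q) 1/q diverges then <P> has density zero, so M_P(x) = o(x)
   trivially; if it converges then \sum_(d in <Q>) 1/d converges, and
   mu_P = 1_<Q> * mu reduces the claim to M(x) = o(x).

   The latter, equivalent to the prime number theorem, is proved by Selberg's
   method.  With Lambda_2 = Lambda log + Lambda * Lambda = mu * log^2 one has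
   mu log^2 = (Lambda * Lambda - Lambda log) * mu, so that
   |M(x)| log^2 x <= \sum_(m <= x) Lambda_2(m) |M(x/m)| + O(x log x), and
   Selberg's formula \sum_(n <= x) Lambda_2(n) = 2 x log x + O(x) turns this into
     |M(N)| log^2 N <=
       2 N \sum_(k <= N) |M(k)| log(N/k) / (k (k+1)) + O(N log N).
   Let s = limsup |M(k)| / k and suppose s > 0.  The sums
   \sum_(k <= n) M(k) / (k (k+1)) are bounded and M is integer valued with steps
   at most 1.  Hence on a long block (Y, 2KY] either M keeps its sign on (Y, KY],
   and the weights |M(k)| / (k (k+1)) have a bounded sum there, or M vanishes at
   some k0, and |M(k)| <= (s/2) k just after k0.  Both cases gain a fixed amount
   per block over the trivial bound, which contradicts the definition of s. *)

(** * Dirichlet convolution *)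

Section Dirichlet.
Variable R : comPzRingType.
Implicit Types f g h : nat -> R.

(** A sum over pairs with product [n], rather than over divisors, turns commutativity and
    associativity into exchanges of sums. *)
Definition dconv f g (n : nat) : R :=
  \sum_(1 <= a < n.+1) \sum_(1 <= b < n.+1 | (a * b == n)%N) f a * g b.

Lemma sum_cond_nat f m (N : nat) (Q : pred nat) : (0 < m)%N ->
  (forall i, Q i -> i = m) -> Q m ->
  \sum_(1 <= i < N.+1 | Q i) f i = if (m <= N)%N then f m else 0.
Proof.
move=> m0 Qm Qmm; have [mN|Nm] := leqP m N.
  rewrite big_mkcond (bigD1_seq m) /= ?mem_index_iota ?iota_uniq ?m0 //=.
  rewrite Qmm big1 ?addr0 // => i im.
  by case: ifP => // /Qm /eqP; rewrite (negbTE im).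
rewrite big_nat_cond big_pred0 // => i.
by apply/negbTE/negP => /andP[/andP[_ iN] /Qm im]; move: iN; rewrite im; lia.
Qed.

(** A range [K] independent of [n] allows a sum over [n] to be exchanged with the sums over [a] and
    [b]. *)
Lemma dconvE K f g n : (n < K)%N -> (0 < n)%N ->
  dconv f g n =
  \sum_(1 <= a < K) \sum_(1 <= b < K | (a * b == n)%N) f a * g b.
Proof.
move=> nK n0; rewrite /dconv.
rewrite [RHS](big_cat_nat (n := n.+1)) //= [X in _ + X]big1_seq ?addr0.
  apply: eq_big_nat => a /andP[a1 an].
  rewrite [RHS](big_cat_nat (n := n.+1)) //= [X in _ + X]big1_seq ?addr0 //.
  move=> b /andP[/eqP ab]; rewrite mem_index_iota => /andP[nb _].
  by exfalso; move: nb; rewrite -ab; nia.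
move=> a; rewrite mem_index_iota => /andP[_ /andP[na _]].
rewrite big_nat_cond big_pred0 // => b.
by apply/negbTE/negP => /andP[/andP[b1 _] /eqP ab]; move: na; rewrite -ab; nia.
Qed.

Lemma dconvC f g n : dconv f g n = dconv g f n.
Proof.
rewrite /dconv (exchange_big_dep xpredT) //=.
apply: eq_bigr => a _; apply: eq_big => b; first by rewrite mulnC.
by rewrite mulrC.
Qed.

Lemma dconv_divE f g n :
  dconv f g n = \sum_(1 <= d < n.+1 | (d %| n)%N) f d * g (n %/ d)%N.
Proof.
rewrite /dconv [RHS]big_mkcond /=; apply: eq_big_nat => a /andP[a1 an].
have [adv|nadv] := boolP (a %| n)%N.
  rewrite (@sum_cond_nat _ (n %/ a)%N) ?leq_div //.
  - by rewrite divn_gt0.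
  - by move=> b /eqP <-; rewrite mulKn.
  - by rewrite mulnC divnK.
rewrite big_pred0 // => b; apply/negbTE/negP => /eqP ab.
by move: nadv; rewrite -ab dvdn_mulr.
Qed.

(** The pairs with [a * b <= N] are collected by their first member. *)
Lemma sum_dconv_weight (w : nat -> R) f g N :
  \sum_(1 <= n < N.+1) w n * dconv f g n =
  \sum_(1 <= a < N.+1) f a * \sum_(1 <= b < (N %/ a).+1) g b * w (a * b)%N.
Proof.
rewrite (eq_big_nat _ _ (F2 := fun n => \sum_(1 <= a < N.+1)
   \sum_(1 <= b < N.+1 | (a * b == n)%N) f a * (g b * w (a * b)%N))); last first.
  move=> n /andP[n1 nN]; rewrite (@dconvE N.+1) // big_distrr /=.
  apply: eq_bigr => a _; rewrite big_distrr /=.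
  by apply: eq_bigr => b /eqP ->; rewrite mulrC mulrA.
rewrite exchange_big /=; apply: eq_big_nat => a /andP[a1 aN].
rewrite (exchange_big_dep xpredT) //= big_distrr /=.
rewrite [RHS](big_nat_widen _ _ N.+1) ?ltnS ?leq_div // [RHS]big_mkcond /=.
apply: eq_big_nat => b /andP[b1 bN].
rewrite (@sum_cond_nat (fun=> f a * (g b * w (a * b)%N)) (a * b)%N) ?ltnS.
- by rewrite leq_divRL // mulnC.
- by rewrite muln_gt0 a1.
- by move=> i /eqP.
- by rewrite eqxx.
Qed.

Lemma sum_dconv f g N : \sum_(1 <= n < N.+1) dconv f g n =
  \sum_(1 <= a < N.+1) f a * \sum_(1 <= b < (N %/ a).+1) g b.
Proof.
rewrite (eq_bigr (fun n => 1 * dconv f g n)) => [|n _]; last by rewrite mul1r.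
rewrite (sum_dconv_weight (fun=> 1)); apply: eq_bigr => a _; congr (_ * _).
by apply: eq_bigr => b _; rewrite mulr1.
Qed.

Lemma eq_dconv f f' g g' n : (forall i, (0 < i)%N -> f i = f' i) ->
  (forall i, (0 < i)%N -> g i = g' i) -> dconv f g n = dconv f' g' n.
Proof.
move=> ff gg; apply: eq_big_nat => a /andP[a1 _].
rewrite big_nat_cond [RHS]big_nat_cond.
by apply: eq_bigr => b /andP[/andP[b1 _] _]; rewrite ff // gg.
Qed.

(** Both sides equal the sum [T] over triples with product [n]: the intermediate product [d] is
    determined by the triple and lies in the range. *)
Lemma dconvA f g h n : dconv (dconv f g) h n = dconv f (dconv g h) n.
Proof.
have [->|n0] := posnP n; first by rewrite /dconv !big_geq.
pose T := \sum_(1 <= a < n.+1) \sum_(1 <= b < n.+1) \sum_(1 <= c < n.+1)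
   if (a * b * c == n)%N then f a * g b * h c else 0.
transitivity T.
  rewrite /dconv.
  rewrite (eq_big_nat _ _ (F2 := fun d => \sum_(1 <= a < n.+1)
     \sum_(1 <= b < n.+1) \sum_(1 <= c < n.+1)
     if ((a * b == d) && (d * c == n))%N then f a * g b * h c else 0)).
    rewrite exchange_big /=; apply: eq_big_nat => a /andP[a1 an].
    rewrite exchange_big /=; apply: eq_big_nat => b /andP[b1 bn].
    rewrite exchange_big /=; apply: eq_big_nat => c /andP[c1 cn].
    rewrite -big_mkcond /=.
    case: eqP => [abc|abc]; last first.
      by rewrite big_pred0 // => d; apply/negbTE/negP => /andP[/eqP<- /eqP].
    rewrite (@sum_cond_nat (fun=> f a * g b * h c) (a * b)%N) //.
    - by rewrite ifT // -abc; nia.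
    - by rewrite muln_gt0 a1.
    - by move=> i /andP[/eqP].
    - by rewrite eqxx abc eqxx.
  move=> d /andP[d1 dn].
  under eq_bigr => c _ do rewrite -/(dconv f g d) (@dconvE n.+1) // big_distrl.
  rewrite (exchange_big_dep xpredT) //=; apply: eq_bigr => a _.
  under eq_bigr => c _ do rewrite big_distrl /=.
  rewrite (exchange_big_dep xpredT) //=; apply: eq_bigr => b _.
  by rewrite big_mkcond; apply: eq_bigr => c _; rewrite andbT andbC.
rewrite -[RHS]/(\sum_(1 <= a < n.+1)
  \sum_(1 <= d < n.+1 | (a * d == n)%N) f a * dconv g h d).
apply: eq_big_nat => a /andP[a1 an].
rewrite [RHS](eq_bigr (fun d => \sum_(1 <= b < n.+1) \sum_(1 <= c < n.+1)
     if ((b * c == d) && (a * d == n))%N then f a * g b * h c else 0)); last first.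
  move=> d /eqP ad; rewrite (@dconvE n.+1) ?big_distrr /=; last 2 first.
  - by rewrite ltnS -ad leq_pmull.
  - by move: n0; rewrite -ad muln_gt0 => /andP[].
  apply: eq_bigr => b _; rewrite big_distrr /= big_mkcond /=.
  by apply: eq_bigr => c _; rewrite ad eqxx andbT mulrA.
rewrite [RHS](exchange_big_dep xpredT) //=; apply: eq_big_nat => b /andP[b1 bn].
rewrite [RHS](exchange_big_dep xpredT) //=; apply: eq_big_nat => c /andP[c1 cn].
rewrite [RHS]big_mkcond [RHS](eq_bigr (fun d => if ((b * c == d) && (a * d == n))%N
   then f a * g b * h c else 0)); last first.
  by move=> d _; case: (a * d == n)%N; rewrite ?andbF.
rewrite -[RHS]big_mkcond /=.
case: eqP => [abc|abc].
  rewrite (@sum_cond_nat (fun=> f a * g b * h c) (b * c)%N) //.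
  - by rewrite ifT // -abc; nia.
  - by rewrite muln_gt0 b1.
  - by move=> i /andP[/eqP].
  - by rewrite eqxx mulnA abc eqxx.
rewrite big_pred0 // => d; apply/negbTE/negP => /andP[/eqP<- /eqP].
by rewrite mulnA.
Qed.

Definition ddelta (n : nat) : R := (n == 1)%:R.

Lemma dconv_deltar f n : (0 < n)%N -> dconv f ddelta n = f n.
Proof.
move=> n0; rewrite dconvC dconv_divE big_ltn_cond //= dvd1n.
rewrite /ddelta eqxx mul1r divn1 big1_seq ?addr0 //.
move=> d /andP[_]; rewrite mem_index_iota => /andP[d1 _].
by case: eqP => [d1'|_]; [move: d1; rewrite d1'|rewrite mul0r].
Qed.

Lemma dconvDr f g h n : dconv f (fun i => g i + h i) n = dconv f g n + dconv f h n.
Proof.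
rewrite /dconv -big_split /=; apply: eq_bigr => a _.
by rewrite -big_split /=; apply: eq_bigr => b _; rewrite mulrDr.
Qed.

Lemma dconvNr f g n : dconv f (fun i => - g i) n = - dconv f g n.
Proof.
rewrite /dconv -sumrN; apply: eq_bigr => a _.
by rewrite -sumrN; apply: eq_bigr => b _; rewrite mulrN.
Qed.

End Dirichlet.

(** * Divisor sums of the Moebius function *)

Lemma sum_multiples (V : nmodType) (p n : nat) (Q : pred nat) (G : nat -> V) :
  (0 < p)%N ->
  \sum_(1 <= d < n.+1 | (p %| d)%N && Q d) G d =
  \sum_(1 <= c < (n %/ p).+1 | Q (p * c)%N) G (p * c)%N.
Proof.
move=> p0; elim: n => [|n IHn]; first by rewrite div0n !big_geq.
rewrite big_mkcond big_nat_recr //= -big_mkcond IHn divnS //.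
have [/dvdnP[k nk]|npn] /= := boolP (p %| n.+1)%N; last by rewrite addr0.
have kE : (n %/ p).+1 = k.
  by have := divnS n p0; rewrite {1 2}nk mulnK // dvdn_mull //= add1n => <-.
by rewrite add1n kE [RHS]big_mkcond big_nat_recr -?kE //= -big_mkcond kE nk mulnC.
Qed.

Section Moebius.
Variable R : realType.
Local Notation mu := (mobius R).

Lemma mobius1 : mu 1 = 1. Proof. by rewrite /mobius /= expr0. Qed.

Lemma mobius_norm_le1 n : `|mu n| <= 1.
Proof.
rewrite /mobius; case: ifP => _; last by rewrite normr0 ler01.
by rewrite normrX normrN1 expr1n.
Qed.

Lemma mobius_intr n : mu n = (mobius int n)%:~R.
Proof. by rewrite /mobius; case: ifP => // _; rewrite rmorphXn /= rmorphN1. Qed.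

Lemma primes_primeM p c : prime p -> ~~ (p %| c)%N -> (0 < c)%N ->
  perm_eq (primes (p * c)) (p :: primes c).
Proof.
move=> pp pc c0; apply: uniq_perm; rewrite ?primes_uniq //=.
  by rewrite primes_uniq mem_primes pp c0 /= pc.
by move=> q; rewrite primesM ?(prime_gt0 pp) // primes_prime // !inE.
Qed.

Lemma mobius_primeM p c : prime p -> ~~ (p %| c)%N -> (0 < c)%N ->
  mu (p * c) = - mu c.
Proof.
move=> pp pc c0; rewrite /mobius /squarefreen muln_gt0 (prime_gt0 pp) /= c0 /=.
have pE := primes_primeM pp pc c0.
rewrite (perm_all _ pE) (perm_size pE) /= lognM ?(prime_gt0 pp) //.
rewrite logn_prime // eqxx (_ : logn p c = 0)%N; last first.
  by apply/eqP; rewrite -leqn0 leqNgt logn_gt0 mem_primes pp c0.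
rewrite addn0 /=.
have -> : all (fun q => logn q (p * c) <= 1)%N (primes c) =
          all (fun q => logn q c <= 1)%N (primes c).
  apply: eq_in_all => q; rewrite mem_primes => /and3P[qp _ qc].
  rewrite lognM ?(prime_gt0 pp) // logn_prime //.
  by case: eqP => // qE; move: pc; rewrite -qE qc.
by case: ifP; rewrite ?oppr0 // exprS mulN1r.
Qed.

Lemma mobius_sqM p c : prime p -> (p %| c)%N -> mu (p * c) = 0.
Proof.
move=> pp pc; rewrite /mobius; case: ifP => // /andP[].
rewrite muln_gt0 => /andP[p0 c0] /allP /(_ p).
rewrite mem_primes pp muln_gt0 p0 c0 dvdn_mulr // => /(_ isT).
rewrite lognM // logn_prime // eqxx.
have : (0 < logn p c)%N by rewrite logn_gt0 mem_primes pp c0.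
lia.
Qed.

Lemma Psmooth_primeM P p c : prime p -> (0 < c)%N ->
  Psmooth P (p * c) = P p && Psmooth P c.
Proof.
move=> pp c0; rewrite /Psmooth muln_gt0 (prime_gt0 pp) /= c0 /=.
apply/allP/andP => [H|[Pp /allP H] q].
  split; first by apply: H; rewrite primesM ?(prime_gt0 pp) // primes_prime // inE eqxx.
  by apply/allP => q qc; apply: H; rewrite primesM ?(prime_gt0 pp) // qc orbT.
by rewrite primesM ?(prime_gt0 pp) // primes_prime // inE => /orP[/eqP->|/H].
Qed.

(** A multiple [p * d] contributes with weight [- mu d] if [p] does not divide [d], and 0 otherwise;
    so each [d] prime to [p] is paired with [p * d]. *)
Lemma sum_mobius_pair p n (f : nat -> R) : prime p -> (p %| n)%N -> (0 < n)%N ->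
  \sum_(1 <= d < n.+1 | (d %| n)%N) mu d * f d =
  \sum_(1 <= d < n.+1 | (d %| n)%N && ~~ (p %| d)%N) mu d * (f d - f (p * d)%N).
Proof.
move=> pp pn n0; rewrite (bigID (fun d => (p %| d)%N)) /=.
rewrite (eq_bigl (fun d => (p %| d) && (d %| n))%N); last by move=> d; rewrite andbC.
rewrite sum_multiples ?prime_gt0 //.
under [RHS]eq_bigr => d _ do rewrite mulrBr.
rewrite [RHS]sumrB [RHS]addrC; congr (_ + _).
rewrite -sumrN [RHS]big_nat_cond.
(* For [d] prime to [p], [d %| n] already gives [p * d %| n] and [d <= n %/ p], so the two ranges
   agree. *)
rewrite [RHS](eq_bigl (fun d => (1 <= d < n.+1)%N &&
    ((p * d %| n)%N && ~~ (p %| d)%N && (d < (n %/ p).+1)%N))); last first.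
  move=> d /=; case: (1 <= d < n.+1)%N => //=.
  have [pd|npd] := boolP (p %| d)%N; first by rewrite !andbF.
  rewrite !andbT Gauss_dvd ?prime_coprime // pn /=.
  have [dn|//] := boolP (d %| n)%N.
  have dnp : (d %| n %/ p)%N.
    rewrite -(@Gauss_dvdr _ p) ?[(p * _)%N]mulnC ?divnK //.
    by rewrite coprime_sym prime_coprime.
  have np0 : (0 < n %/ p)%N by rewrite divn_gt0 ?prime_gt0 // dvdn_leq.
  by rewrite ltnS (dvdn_leq np0 dnp).
rewrite -[RHS]big_nat_cond -big_nat_widen ?ltnS ?leq_div //.
rewrite [RHS]big_mkcondr [LHS]big_nat_cond [RHS]big_nat_cond /=.
apply: eq_bigr => d /andP[/andP[d1 _] dn].
case: ifP => [pd|/negbFE pd]; first by rewrite mobius_primeM // mulNr.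
by rewrite mobius_sqM // mul0r.
Qed.

Definition nofactor (P : pred nat) (n : nat) : bool :=
  ~~ has P (primes n).

(** If some [p] in [P] divides [n], then [d] and [p * d] are smooth together and the paired terms
    cancel; otherwise 1 is the only smooth divisor. *)
Lemma sum_mobius_smooth P n : (0 < n)%N ->
  \sum_(1 <= d < n.+1 | (d %| n)%N && Psmooth P d) mu d = (nofactor P n)%:R.
Proof.
move=> n0; rewrite big_mkcondr /=.
rewrite (eq_bigr (fun d => mu d * (Psmooth P d)%:R)); last first.
  by move=> d _; case: ifP; rewrite ?mulr1 ?mulr0.
rewrite /nofactor; case: hasP => [[p]|nP].
  rewrite mem_primes => /and3P[pp _ pn] Pp.
  rewrite (sum_mobius_pair _ pp pn n0) big_nat_cond big1 // => d.
  by move=> /andP[/andP[d1 _] _]; rewrite Psmooth_primeM // Pp subrr mulr0.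
rewrite big_mkcond big_ltn // dvd1n /= mobius1 mul1r big1_seq ?addr0 // => d.
rewrite mem_index_iota => /andP[_ /andP[d1 dn]]; case: ifP => // ddn.
have [/andP[_ /allP Pd]|_] := boolP (Psmooth P d); last by rewrite mulr0.
case: nP; exists (pdiv d); first by rewrite mem_primes pdiv_prime // n0 (dvdn_trans (pdiv_dvd d)).
by apply: Pd; rewrite mem_primes pdiv_prime // pdiv_dvd ltnW.
Qed.

Definition mobiusP (P : pred nat) (n : nat) : R := if Psmooth P n then mu n else 0.

Lemma mobiusP_conv P n : (0 < n)%N -> dconv (mobiusP P) (fun=> 1) n = (nofactor P n)%:R.
Proof.
move=> n0; rewrite -sum_mobius_smooth // dconv_divE big_mkcondr.
by apply: eq_bigr => d _; rewrite mulr1.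
Qed.

Lemma Psmooth_T n : Psmooth xpredT n = (0 < n)%N.
Proof. by rewrite /Psmooth all_predT andbT. Qed.

Lemma mobiusP_T n : mobiusP xpredT n = mu n.
Proof. by rewrite /mobiusP Psmooth_T; case: n. Qed.

Lemma nofactor_T n : (0 < n)%N -> nofactor xpredT n = (n == 1)%N.
Proof.
case: n => [|[|n]] // _; rewrite /nofactor has_predT lt0n size_eq0 /=.
by apply/negbTE; rewrite negbK primes_eq0.
Qed.

Lemma mobius_conv n : (0 < n)%N -> dconv mu (fun=> 1) n = ddelta R n.
Proof.
move=> n0; rewrite -(eq_dconv (f := mobiusP xpredT) (g := fun=> 1)) //; last first.
  by move=> i _; rewrite mobiusP_T.
by rewrite mobiusP_conv // nofactor_T.
Qed.

Lemma mobius_inversion (f g : nat -> R) n : (0 < n)%N ->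
  (forall i, (0 < i)%N -> dconv f (fun=> 1) i = g i) -> f n = dconv g mu n.
Proof.
move=> n0 fg; rewrite -(eq_dconv (f := dconv f (fun=> 1)) (g := mu)) //.
rewrite dconvA (eq_dconv (f' := f) (g' := ddelta R)) ?dconv_deltar //.
by move=> i i0; rewrite dconvC mobius_conv.
Qed.

End Moebius.

(** * The von Mangoldt function and Selberg's function *)

Section VonMangoldt.
Variable R : realType.
Local Notation mu := (mobius R).
Implicit Types (f g : nat -> R) (n N : nat).

(** As [ln] is 0 at 0, [lnn] is nonnegative and nondecreasing on all of [nat]. *)
Definition lnn n : R := ln n%:R.

Lemma lnn1 : lnn 1 = 0. Proof. exact: ln1. Qed.

Lemma lnnM a b : (0 < a)%N -> (0 < b)%N -> lnn (a * b) = lnn a + lnn b.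
Proof. by move=> a0 b0; rewrite /lnn natrM lnM // posrE ltr0n. Qed.

Lemma lnn_ge0 n : 0 <= lnn n.
Proof. by case: n => [|n]; [rewrite /lnn ln0|rewrite /lnn ln_ge0 // ler1n]. Qed.

Lemma ler_lnn m n : (m <= n)%N -> lnn m <= lnn n.
Proof.
case: m => [|m] mn; first by rewrite {1}/lnn ln0 // lnn_ge0.
by rewrite /lnn ler_ln ?posrE ?ltr0n ?ler_nat // (leq_trans _ mn).
Qed.

Lemma lnnS_le n : (0 < n)%N -> lnn n.+1 - lnn n <= n%:R^-1.
Proof.
move=> n0; have n0R : (0 : R) < n%:R by rewrite ltr0n.
rewrite /lnn -ln_div ?posrE ?ltr0n // -natr1 mulrDl divff ?gt_eqF // mul1r.
by apply: le_ln1Dx; apply: lt_trans (_ : 0 < _); rewrite ?invr_gt0 // oppr_lt0 ltr01.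
Qed.

Lemma lnnS_ge n : (0 < n)%N -> n.+1%:R^-1 <= lnn n.+1 - lnn n.
Proof.
move=> n0; have n0R : (0 : R) < n%:R by rewrite ltr0n.
have n1R : (0 : R) < n.+1%:R by rewrite ltr0n.
rewrite -lerN2 opprB /lnn -ln_div ?posrE //.
have -> : n%:R / n.+1%:R = 1 + - n.+1%:R^-1 :> R.
  by rewrite -{1}(addrK 1 n%:R) natr1 mulrBl divff ?gt_eqF // mul1r.
apply: le_ln1Dx; rewrite ltrN2 invf_lt1 // ltr1n; lia.
Qed.

(** Since [ln] is additive on products, multiplication by it is a derivation for the convolution. *)
Lemma dconv_lnn f g n :
  dconv f g n * lnn n =
  dconv (fun i => f i * lnn i) g n + dconv f (fun i => g i * lnn i) n.
Proof.
rewrite /dconv big_distrl -big_split /=; apply: eq_big_nat => a /andP[a0 _].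
rewrite big_distrl -big_split /= big_nat_cond [RHS]big_nat_cond.
apply: eq_bigr => b /andP[/andP[b0 _] /eqP <-].
by rewrite lnnM //; ring.
Qed.

Definition vonmangoldt n : R := dconv mu lnn n.
Local Notation Lam := vonmangoldt.

Lemma Psmooth_predC1 p n : prime p -> (0 < n)%N ->
  Psmooth (predC1 p) n = ~~ (p %| n)%N.
Proof.
move=> pp n0; rewrite /Psmooth n0 /=; apply/allP/idP => [H|H q].
  by apply/negP => pn; have := H p; rewrite mem_primes pp n0 pn /= eqxx => /(_ isT).
rewrite mem_primes => /and3P[_ _ qn] /=.
by apply/eqP => qp; move: H; rewrite -qp qn.
Qed.

(** With [p] the least prime factor of [n], pairing [d] with [p * d] leaves [ln p] times the sum of
    [mu d] over the divisors prime to [p], which is 0 or 1 by [sum_mobius_smooth] for the predicate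
    [predC1 p]. *)
Lemma vonmangoldt_ge0 n : 0 <= Lam n.
Proof.
have [n1|n1] := leqP n 1.
  case: n n1 => [|[|//]] _; first by rewrite /vonmangoldt /dconv big_geq.
  by rewrite /vonmangoldt dconv_divE big_mkcond big_nat1 /= divn1 lnn1 mulr0.
have n0 := ltnW n1; have pp := pdiv_prime n1.
rewrite /vonmangoldt dconv_divE big_nat_cond.
rewrite (eq_bigr (fun d => mu d * (lnn n - lnn d))); last first.
  move=> d /andP[/andP[d1 _] dn]; rewrite -{2}(divnK dn) lnnM ?addrK //.
  by rewrite divn_gt0 // dvdn_leq.
rewrite -big_nat_cond (sum_mobius_pair _ pp (pdiv_dvd n)) // big_nat_cond.
rewrite (eq_bigr (fun d => mu d * lnn (pdiv n))); last first.
  move=> d /andP[/andP[d1 _] _]; rewrite lnnM ?pdiv_gt0 //; congr (_ * _); ring.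
rewrite -big_distrl mulr_ge0 ?lnn_ge0 //=.
rewrite (eq_bigl (fun d => (1 <= d < n.+1)%N && ((d %| n)%N && Psmooth (predC1 (pdiv n)) d))).
  by rewrite -big_nat_cond sum_mobius_smooth ?ler0n.
move=> d; apply: andb_id2l => /andP[d1 _]; apply: andb_id2l => _.
by rewrite Psmooth_predC1.
Qed.

Lemma vonmangoldt_conv n : (0 < n)%N -> dconv Lam (fun=> 1) n = lnn n.
Proof.
move=> n0; rewrite dconvC -dconvA.
rewrite dconvC (eq_dconv (f' := lnn) (g' := ddelta R)) ?dconv_deltar // => i i0.
by rewrite dconvC mobius_conv.
Qed.

Definition selberg n : R := Lam n * lnn n + dconv Lam Lam n.
Local Notation Lam2 := selberg.

Lemma dconv_ge0 f g n : (forall i, 0 <= f i) -> (forall i, 0 <= g i) ->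
  0 <= dconv f g n.
Proof. by move=> f0 g0; apply: sumr_ge0 => a _; apply: sumr_ge0 => b _; apply: mulr_ge0. Qed.

(** By inversion it suffices that [Lam2 * 1 = ln^2]. The derivation rule applied to [Lam * 1 = ln]
    gives [ln^2 = (Lam ln) * 1 + Lam * ln], and [Lam * ln = Lam * Lam * 1]. *)
Lemma selbergE n : (0 < n)%N -> Lam2 n = dconv mu (fun i => lnn i ^+ 2) n.
Proof.
move=> n0; rewrite dconvC; apply: mobius_inversion => // i i0.
rewrite dconvC dconvDr [X in X + _]dconvC [X in _ + X]dconvC expr2.
rewrite -{1}vonmangoldt_conv // dconv_lnn; congr (_ + _).
rewrite dconvA; apply: eq_dconv => // j j0.
by rewrite vonmangoldt_conv // mul1r.
Qed.

(** The derivation rule applied to [mu * 1 = ddelta], which [ln] annihilates, gives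
    [(mu ln) * 1 = - Lam]. *)
Lemma mobius_lnn n : (0 < n)%N -> mu n * lnn n = - dconv Lam mu n.
Proof.
move=> n0; rewrite dconvC -dconvNr dconvC.
apply: (mobius_inversion (f := fun i => mu i * lnn i)) => // i i0.
have := dconv_lnn mu (fun=> 1) i; rewrite mobius_conv //.
have -> : ddelta R i * lnn i = 0.
  by rewrite /ddelta; case: eqP => [->|_]; rewrite ?lnn1 ?mulr0 ?mul0r.
rewrite (eq_dconv (f := mu) (f' := mu) (g' := lnn) (g := fun i => 1 * lnn i)) //; last first.
  by move=> j _; rewrite mul1r.
by move/esym/eqP; rewrite addr_eq0 => /eqP.
Qed.

(** [mobius_lnn] is used twice, with the derivation rule in between. *)
Lemma mobius_lnn2 n : (0 < n)%N ->
  mu n * lnn n ^+ 2 = dconv (fun m => dconv Lam Lam m - Lam m * lnn m) mu n.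
Proof.
move=> n0; rewrite expr2 mulrA mobius_lnn // mulNr dconv_lnn.
rewrite [X in _ + X](eq_dconv (f' := Lam) (g' := fun i => - dconv Lam mu i)) //; last first.
  by move=> i i0; rewrite mobius_lnn.
rewrite dconvNr opprD opprK -dconvA addrC dconvC.
rewrite [X in _ - X]dconvC -dconvNr; rewrite -[X in X + _]dconvC dconvC.
rewrite [RHS]dconvC dconvDr.
by rewrite [X in X + _]dconvC dconvNr.
Qed.

(* Generalised Moebius inversion: [F x = \sum_(n <= x) f (x / n)] gives
   [f x = \sum_(d <= x) mu d * F (x / d)]; here [w m] stands for [f (N / m)]. *)
Lemma mobius_inversion_sum (w : nat -> R) N : (0 < N)%N ->
  \sum_(1 <= d < N.+1) mu d * \sum_(1 <= n < (N %/ d).+1) w (d * n)%N = w 1%N.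
Proof.
move=> N0; transitivity (\sum_(1 <= n < N.+1) w n * dconv mu (fun=> 1) n).
  rewrite sum_dconv_weight; apply: eq_bigr => a _; congr (_ * _).
  by apply: eq_bigr => b _; rewrite mul1r.
rewrite (eq_big_nat _ _ (F2 := fun n => w n * ddelta R n)); last first.
  by move=> n /andP[n1 _]; rewrite mobius_conv.
rewrite big_ltn // /ddelta eqxx mulr1 big1_seq ?addr0 // => n.
rewrite mem_index_iota => /andP[_ /andP[n2 _]].
by case: eqP => [n1|]; [move: n2; rewrite n1|rewrite mulr0].
Qed.

End VonMangoldt.

(** * Elementary estimates of logarithmic sums *)

Section Estimates.
Variable R : realType.
Local Notation mu := (mobius R).
Local Notation L := (@lnn R).
Implicit Types (c u e : nat -> R) (n N d : nat).

(** The sequence [u - e] is nondecreasing, [u + e] is nonincreasing, and the first stays below the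
    second; [l] is the supremum of the first. *)
Lemma cvg_telescope_bound u e : (forall n, 0 <= e n) ->
  (forall n, (0 < n)%N -> `|u n.+1 - u n| <= e n - e n.+1) ->
  exists l, forall n, (0 < n)%N -> `|u n - l| <= e n.
Proof.
move=> e0 ue.
have step n k : (0 < n)%N -> u n - e n <= u (n + k)%N - e (n + k)%N /\
    u (n + k)%N + e (n + k)%N <= u n + e n.
  move=> n0; elim: k => [|k [IH1 IH2]]; first by rewrite addn0.
  have := ue (n + k)%N; rewrite addn_gt0 n0 /= => /(_ isT).
  rewrite addnS ler_norml => /andP[h1 h2]; split; lra.
have vw n m : (0 < n)%N -> (0 < m)%N -> u n - e n <= u m + e m.
  move=> n0 m0; have [h1 _] := step n m n0; have [_ h2] := step m n m0.
  by have := e0 (n + m)%N; rewrite addnC in h2; lra.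
pose A : set R := [set x | exists2 n, (0 < n)%N & x = u n - e n].
have A0 : A !=set0 by exists (u 1%N - e 1%N), 1%N.
have Aub m : (0 < m)%N -> ubound A (u m + e m) by move=> m0 x [n n0 ->]; exact: vw.
exists (sup A) => n n0; rewrite ler_norml.
have h1 : u n - e n <= sup A.
  by apply: ub_le_sup; [exists (u 1%N + e 1%N); exact: Aub|exists n].
have h2 : sup A <= u n + e n by apply: ge_sup => //; exact: Aub.
lra.
Qed.

Lemma natr_divn_le N d : (0 < d)%N -> (N %/ d)%:R <= N%:R / d%:R :> R.
Proof. by move=> d0; rewrite ler_pdivlMr ?ltr0n // -natrM ler_nat leq_trunc_div. Qed.

Lemma natr_divn_gt N d : (0 < d)%N -> N%:R / d%:R < (N %/ d)%:R + 1 :> R.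
Proof.
move=> d0; rewrite ltr_pdivrMr ?ltr0n // natr1 -natrM ltr_nat.
by rewrite -ltn_divLR.
Qed.

Lemma lnn_lenat n : L n <= n%:R.
Proof.
case: n => [|n]; first by rewrite /lnn ln0.
by apply/ltW/ln_sublinear; rewrite ltr0n.
Qed.

Lemma lnn_divn_bounds N d : (0 < d <= N)%N ->
  L (N %/ d) <= L N - L d <= L (N %/ d) + (N %/ d)%:R^-1.
Proof.
move=> /andP[d0 dN]; have k0 : (0 < N %/ d)%N by rewrite divn_gt0.
apply/andP; split.
  rewrite lerBrDr -lnnM //; apply: ler_lnn; exact: leq_trunc_div.
have h : L N <= L ((N %/ d).+1 * d)%N by apply: ler_lnn; rewrite ltnW // -ltn_divLR.
move: h; rewrite lnnM // => h; have := lnnS_le R k0; lra.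
Qed.

Lemma inv_divn_le N d : (0 < d <= N)%N ->
  (N %/ d)%:R^-1 <= 2 * (d%:R / N%:R) :> R.
Proof.
move=> /andP[d0 dN]; have k0 : (0 < N %/ d)%N by rewrite divn_gt0.
have N0 : (0 < N)%N by lia.
rewrite -[leLHS]mul1r ler_pdivrMr ?ltr0n // mulrAC mulrA ler_pdivlMr ?ltr0n // mul1r.
rewrite -[2]/(2%:R) -!natrM ler_nat.
have : (N < (N %/ d).+1 * d)%N by rewrite -ltn_divLR.
nia.
Qed.

(** This is the integral of [C(t) / t] over [[1, N]], where [C] is the summatory function of [c]. *)
Definition logmean c N : R := \sum_(1 <= n < N.+1) c n * (L N - L n).

Lemma logmeanS c N : logmean c N.+1 =
  logmean c N + (L N.+1 - L N) * \sum_(1 <= n < N.+1) c n.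
Proof.
rewrite /logmean big_nat_recr //= subrr mulr0 addr0 big_distrr -big_split /=.
by apply: eq_bigr => n _; ring.
Qed.

Lemma logmean0 c : logmean c 0 = 0. Proof. by rewrite /logmean big_geq. Qed.

Lemma logmean1 c : logmean c 1 = 0.
Proof. by rewrite /logmean big_nat1 subrr mulr0. Qed.

(** By [logmeanS], each increment is at most [(1 / N) (C N) = C]. *)
Lemma logmean_linear c C : 0 <= C ->
  (forall N, (0 < N)%N -> \sum_(1 <= n < N.+1) c n <= C * N%:R) ->
  forall N, logmean c N <= C * N%:R.
Proof.
move=> C0 cC; case=> [|N]; first by rewrite logmean0 mulr0.
elim: N => [|N IH]; first by rewrite logmean1 mulr_ge0.
rewrite logmeanS -[N.+2%:R]natr1 mulrDr mulr1 lerD //.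
have N0 : (0 < N.+1)%N by [].
have h1 := lnnS_le R N0; have h2 := cC _ N0.
have h0 : 0 <= L N.+2 - L N.+1 by rewrite subr_ge0; apply: ler_lnn.
apply: le_trans (ler_wpM2l h0 h2) _.
have NR : (0 : R) < N.+1%:R by rewrite ltr0n.
rewrite mulrC -mulrA -[leRHS]mulr1 ler_wpM2l //.
by rewrite -ler_pdivlMl // mulr1.
Qed.

Lemma sum_nat1 N : \sum_(1 <= n < N.+1) 1 = N%:R :> R.
Proof. by rewrite big_const_nat iter_addr_0 subSS subn0. Qed.

Lemma sum_ln_ratio N : \sum_(1 <= n < N.+1) (L N - L n) <= N%:R.
Proof.
rewrite (eq_bigr (fun n => 1 * (L N - L n))) => [|n _]; last by rewrite mul1r.
rewrite -[N%:R]mul1r; apply: (@logmean_linear (fun=> 1) 1 ler01) => M _.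
by rewrite sum_nat1 mul1r.
Qed.

(** With [t = ln (N + 1) - ln N <= 1 / N], passing from [N] to [N + 1] adds [2 t] times the sum of
    [sum_ln_ratio], at most 2, and [t^2 N], at most 1. *)
Lemma sum_ln_ratio2 N : \sum_(1 <= n < N.+1) (L N - L n) ^+ 2 <= 3 * N%:R.
Proof.
case: N => [|N]; first by rewrite big_geq // mulr0.
elim: N => [|N IH]; first by rewrite big_nat1 subrr expr0n /= mulr1.
rewrite big_nat_recr //= subrr expr0n /= addr0.
have N0 : (0 < N.+1)%N by [].
have NR : (0 : R) < N.+1%:R by rewrite ltr0n.
set t := L N.+2 - L N.+1.
have t1 : t <= N.+1%:R^-1 := lnnS_le R N0.
have t0 : 0 <= t by rewrite subr_ge0; apply: ler_lnn.
have tN : t * N.+1%:R <= 1 by rewrite -ler_pdivlMr // mul1r.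
have tle1 : t <= 1 by apply: le_trans t1 _; rewrite invf_le1 // ler1n.
rewrite (eq_bigr (fun n => (L N.+1 - L n) ^+ 2 + (t * 2 * (L N.+1 - L n) + t ^+ 2 * 1))); last first.
  by move=> n _; rewrite /t; ring.
rewrite big_split /= big_split /= -!big_distrr /= sum_nat1.
have h := sum_ln_ratio N.+1.
have : t * 2 * \sum_(1 <= n < N.+2) (L N.+1 - L n) <= t * 2 * N.+1%:R.
  by apply: ler_wpM2l => //; lra.
have : t ^+ 2 * N.+1%:R <= 1 by rewrite expr2 -mulrA mulr_ile1 // mulr_ge0.
by rewrite -[N.+2%:R]natr1; lra.
Qed.

Definition harm N : R := \sum_(1 <= n < N.+1) n%:R^-1.

(** Here [g] is Euler's constant; the increments of [harm n - ln n] lie between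
    [1 / (n + 1) - 1 / n] and 0. *)
Lemma harm_asymp : exists g, forall n, (0 < n)%N -> `|harm n - L n - g| <= n%:R^-1.
Proof.
apply: (@cvg_telescope_bound (fun n => harm n - L n) (fun n => n%:R^-1)).
  by move=> n; rewrite invr_ge0.
move=> n n0; have -> : harm n.+1 = harm n + n.+1%:R^-1 by rewrite /harm big_nat_recr.
have := lnnS_le R n0; have := lnnS_ge R n0.
move: n.+1%:R^-1 => a; rewrite ler_norml => h1 h2.
by apply/andP; split; lra.
Qed.

Lemma harm_le N : harm N <= L N + 1.
Proof.
case: N => [|N]; first by rewrite /harm big_geq // addr_ge0 ?lnn_ge0.
elim: N => [|N IH]; first by rewrite /harm big_nat1 lnn1 add0r invr1.
rewrite /harm big_nat_recr //= -/(harm N.+1).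
by have := @lnnS_ge R N.+1 isT; move: N.+2%:R^-1 => a h; lra.
Qed.

Lemma sum_lnn_div_asymp : exists g, forall n, (0 < n)%N ->
  `|\sum_(1 <= k < n.+1) L k / k%:R - L n ^+ 2 / 2 - g| <= 2 * (L n + 2) / n%:R.
Proof.
apply: (@cvg_telescope_bound (fun n => \sum_(1 <= k < n.+1) L k / k%:R - L n ^+ 2 / 2)
  (fun n => 2 * (L n + 2) / n%:R)).
  by move=> n; rewrite divr_ge0 // mulr_ge0 // addr_ge0 // lnn_ge0.
move=> n n0; rewrite [\sum_(_ <= _ < n.+2) _]big_nat_recr //=.
have nR : (0 : R) < n%:R by rewrite ltr0n.
have n1R : (0 : R) < n.+1%:R by rewrite ltr0n.
have h1 := lnnS_le R n0; have h2 := lnnS_ge R n0.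
have Ln := lnn_ge0 R n.
set S := \sum_(_ <= _ < _) _.
have LE : L n.+1 = L n + (L n.+1 - L n) by ring.
move: h1 h2 LE; set t := L n.+1 - L n => h1 h2 ->.
move: Ln; set l := L n => l0.
have iE : n.+1%:R^-1 = n%:R^-1 - n%:R^-1 * n.+1%:R^-1 :> R.
  by rewrite -natr1; field; rewrite natr1 !gt_eqF.
move: h1 h2 iE; set a := n%:R^-1; set b := n.+1%:R^-1 => h1 h2 iE.
have a0 : 0 < a by rewrite invr_gt0.
have b0 : 0 < b by rewrite invr_gt0.
have ab : a <= 2 * b.
  rewrite /a /b -[leLHS]mul1r ler_pdivrMr // mulrAC ler_pdivlMr // mul1r.
  by rewrite -[2]/(2%:R) -natrM ler_nat; lia.
have a1 : a <= 1 by rewrite invf_le1 // ler1n.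
clearbody a b t l.
(* This is the increment of the sequence, with [l = ln n], [a = 1 / n] and [b = 1 / (n + 1)]. Its
   terms and the decrease of the error bound are all compared with [a * b = a - b]. *)
rewrite (_ : _ - _ = (l + t) * (b - t) + t ^+ 2 / 2); last by field.
have E : 2 * (l + 2) * a - 2 * (l + t + 2) * b = 2 * (l + 2) * (a * b) - 2 * t * b.
  by rewrite {1}(_ : a = b + a * b); [ring|rewrite {1}iE; ring].
rewrite E.
have tb : 0 <= t - b by lra.
have tab : t - b <= a * b by lra.
have t1 : t <= 1 by lra.
have X1 : (l + t) * (t - b) <= (l + 1) * (a * b) by apply: ler_pM => //; lra.
have t0 : 0 <= t by lra.
have X2 : t ^+ 2 <= 2 * (a * b).
  by apply: le_trans (ler_pM t0 t0 h1 h1) _; rewrite mulrCA ler_wpM2l // ltW.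
have X3 : t * b <= a * b by apply: ler_wpM2r; lra.
have X4 : 0 <= l * (a * b) by rewrite !mulr_ge0 // ltW.
have X5 : 0 <= (l + t) * (t - b) by rewrite mulr_ge0 //; lra.
have X6 : 0 <= t ^+ 2 by rewrite sqr_ge0.
by rewrite ler_norml; apply/andP; split; nra.
Qed.

End Estimates.

(** * Chebyshev's bound and Selberg's formula *)

Section Selberg.
Variable R : realType.
Local Notation mu := (mobius R).
Local Notation L := (@lnn R).
Local Notation Lam := (@vonmangoldt R).
Local Notation Lam2 := (@selberg R).
Implicit Types (n N d : nat).

Lemma norm_sum_mobius_le N (g b : nat -> R) :
  (forall d, (0 < d <= N)%N -> `|g d| <= b d) ->
  `|\sum_(1 <= d < N.+1) mu d * g d| <= \sum_(1 <= d < N.+1) b d.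
Proof.
move=> gb; apply: le_trans (ler_norm_sum _ _ _) _.
apply: ler_sum_nat => d dN; rewrite normrM -[leRHS]mul1r.
by apply: ler_pM => //; [exact: mobius_norm_le1|exact: gb].
Qed.

(** Replacing the floor of [N / d] by [N / d] costs at most [a d] in each term. This links sums of
    divisor sums, where the floor occurs, to sums of [mu d / d] with weights. *)
Lemma sum_mobius_floor N (a : nat -> R) : (forall d, (0 < d <= N)%N -> 0 <= a d) ->
  `|\sum_(1 <= d < N.+1) mu d * (a d * (N %/ d)%:R) -
    N%:R * \sum_(1 <= d < N.+1) mu d * (a d / d%:R)| <= \sum_(1 <= d < N.+1) a d.
Proof.
move=> a0; rewrite big_distrr -sumrB /=.
rewrite (eq_bigr (fun d => mu d * (a d * ((N %/ d)%:R - N%:R / d%:R)))) => [|d _]; last by ring.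
apply: norm_sum_mobius_le => d dN; have ad := a0 d dN.
have d0 : (0 < d)%N by case/andP: dN.
rewrite normrM ger0_norm // -[leRHS]mulr1 ler_wpM2l // ler_norml.
by have := natr_divn_le R N d0; have := natr_divn_gt R N d0; lra.
Qed.

(** The sum of [mu d] times the floor of [N / d] is 1, so [|N S - 1| <= N] for the sum [S] in
    question. *)
Lemma sum_mobius_div_le N : (0 < N)%N -> `|\sum_(1 <= d < N.+1) mu d / d%:R| <= 2.
Proof.
move=> N0; have NR : (0 : R) < N%:R by rewrite ltr0n.
have := @sum_mobius_floor N (fun=> 1) (fun _ _ => ler01); rewrite sum_nat1.
have -> : \sum_(1 <= d < N.+1) mu d * (1 * (N %/ d)%:R) = 1.
  rewrite -[RHS](mobius_inversion_sum (fun=> 1) N0); apply: eq_bigr => d _.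
  by rewrite mul1r sum_nat1.
rewrite (eq_bigr (fun d => mu d / d%:R)) => [|d _]; last by rewrite mul1r.
move: (\sum_(_ <= _ < _) _) => S; rewrite ler_norml => /andP[h1 h2].
have N1 : (1 : R) <= N%:R by rewrite ler1n.
by rewrite -(ler_pM2l NR) -{1}(gtr0_norm NR) -normrM ler_norml; apply/andP; split; lra.
Qed.

(** Both [harm_asymp] at [N %/ d] and the passage from [ln (N %/ d)] to [ln (N / d)] cost at most
    [1 / (N %/ d) <= 2 d / N]. *)
Lemma harm_divn : exists g : R, forall N d, (0 < d <= N)%N ->
  `|harm R (N %/ d) - (L N - L d) - g| <= 4 * (d%:R / N%:R).
Proof.
have [g hg] := harm_asymp R; exists g => N d dN.
have k0 : (0 < N %/ d)%N by rewrite divn_gt0; lia.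
have := hg _ k0; have := lnn_divn_bounds R dN; have := inv_divn_le R dN.
move: (_%:R^-1) (d%:R / N%:R) => a b ab /andP[h1 h2].
rewrite !ler_norml => /andP[h3 h4]; apply/andP; split; lra.
Qed.

(** Inversion with [w m = 1 / m] shows that [mu d / d] summed against the harmonic sums up to
    [N / d] gives 1. These are [ln (N / d) + g] up to [O(d / N)], and [g] is handled by
    [sum_mobius_div_le]. *)
Lemma sum_mobius_ln_bounded : exists C : R, forall N, (0 < N)%N ->
  `|\sum_(1 <= d < N.+1) mu d * ((L N - L d) / d%:R)| <= C.
Proof.
have [g hC] := harm_divn; exists (1 + `|g| * 2 + 4) => N N0.
have NR : (0 : R) < N%:R by rewrite ltr0n.
have E : \sum_(1 <= d < N.+1) mu d * (harm R (N %/ d) / d%:R) = 1.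
  rewrite -[RHS]invr1 -(mobius_inversion_sum (fun m => m%:R^-1) N0).
  apply: eq_bigr => d _; congr (_ * _); rewrite /harm big_distrl /=.
  by apply: eq_bigr => n _; rewrite natrM invfM mulrC.
have -> : \sum_(1 <= d < N.+1) mu d * ((L N - L d) / d%:R) =
  1 - g * (\sum_(1 <= d < N.+1) mu d / d%:R) -
  \sum_(1 <= d < N.+1) mu d * ((harm R (N %/ d) - (L N - L d) - g) / d%:R).
  rewrite -[X in X - _ - _]E big_distrr -!sumrB /=; apply: eq_bigr => d _; ring.
apply: le_trans (ler_normB _ _) _; apply: lerD.
  apply: le_trans (ler_normB _ _) _; rewrite normr1 lerD2l normrM ler_wpM2l //.
  exact: sum_mobius_div_le.
apply: le_trans (norm_sum_mobius_le (b := fun d => 4 / N%:R * 1) _) _.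
  move=> d dN; have dR : (0 : R) < d%:R by rewrite ltr0n; lia.
  rewrite normrM normfV (gtr0_norm dR) ler_pdivrMr //.
  by apply: le_trans (hC N d dN) _; rewrite mulr1 mulrAC mulrA.
by rewrite -big_distrr /= sum_nat1 divfK ?gt_eqF.
Qed.

(** Inversion with [w m = ln (N / m) / m], whose value at 1 is [ln N]. The inner sum [G d] is
    [ln^2 (N / d) / 2 + g ln (N / d) - c] up to a small error; the half explains the main term
    [2 ln N]. *)
Lemma sum_mobius_ln2 : exists C : R, forall N, (0 < N)%N ->
  `|\sum_(1 <= d < N.+1) mu d * ((L N - L d) ^+ 2 / d%:R) - 2 * L N| <= C.
Proof.
have [g hC1] := harm_divn; have [c hc] := sum_lnn_div_asymp R.
have [C2 hC2] := sum_mobius_ln_bounded.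
exists (2 * (`|g| * C2 + `|c| * 2 + 18)) => N N0.
have NR : (0 : R) < N%:R by rewrite ltr0n.
pose G d := \sum_(1 <= n < (N %/ d).+1) (L N - L d - L n) / n%:R.
have E : \sum_(1 <= d < N.+1) mu d * (G d / d%:R) = L N.
  transitivity (1%:R^-1 * (L N - L 1)); last by rewrite invr1 mul1r lnn1 subr0.
  rewrite -(mobius_inversion_sum (fun m => m%:R^-1 * (L N - L m)) N0).
  apply: eq_big_nat => d /andP[d0 _]; congr (_ * _); rewrite /G big_distrl /=.
  apply: eq_big_nat => n /andP[n0 _]; rewrite natrM invfM lnnM //; ring.
have GE d : G d = (L N - L d) * harm R (N %/ d) -
    \sum_(1 <= n < (N %/ d).+1) L n / n%:R.
  by rewrite /G /harm big_distrr -sumrB /=; apply: eq_bigr => n _; ring.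
pose r d := G d - ((L N - L d) ^+ 2 / 2 + g * (L N - L d) - c).
have rb d : (0 < d <= N)%N -> `|r d| <= (4 * (L N - L d) + (6 * (L N - L d) + 8)) * (d%:R / N%:R).
  move=> dN; rewrite /r GE.
  have k0 : (0 < N %/ d)%N by rewrite divn_gt0; lia.
  have Y0 : 0 <= L N - L d by rewrite subr_ge0 ler_lnn //; case/andP: dN.
  have a0 : 0 <= (N %/ d)%:R^-1 :> R by rewrite invr_ge0.
  have l0 := lnn_ge0 R (N %/ d).
  have := hc _ k0; have := lnn_divn_bounds R dN; have := inv_divn_le R dN.
  have := hC1 _ _ dN.
  move: (L N - L d) Y0 (harm R _) (L _) l0 (\sum_(_ <= _ < _) _) (_%:R^-1) a0 (d%:R / N%:R).
  move=> Y Y0 H l l0 S a a0 b h1 ab /andP[lY Yl] h2.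
  rewrite (_ : _ - _ = Y * (H - Y - g) + ((Y - l) * (Y + l) / 2 - (S - l ^+ 2 / 2 - c))); last by field.
  apply: le_trans (ler_normD _ _) _.
  rewrite [leRHS]mulrDl; apply: lerD.
    by rewrite normrM (ger0_norm Y0) [4 * Y]mulrC -mulrA ler_wpM2l.
  apply: le_trans (ler_normB _ _) _.
  have -> : (6 * Y + 8) * b = 2 * b * Y + 2 * (Y + 2) * (2 * b) by ring.
  apply: lerD.
    have X0 : 0 <= (Y - l) * (Y + l) / 2.
      by rewrite divr_ge0 // mulr_ge0 // ?subr_ge0 // addr_ge0.
    rewrite (ger0_norm X0) -mulrA; apply: ler_pM; [lra|lra|lra|lra].
  by apply: le_trans h2 _; apply: ler_pM => //; lra.
have -> : \sum_(1 <= d < N.+1) mu d * ((L N - L d) ^+ 2 / d%:R) - 2 * L N =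
  2 * (- g * (\sum_(1 <= d < N.+1) mu d * ((L N - L d) / d%:R)) +
       c * (\sum_(1 <= d < N.+1) mu d / d%:R) -
       \sum_(1 <= d < N.+1) mu d * (r d / d%:R)).
  rewrite -[X in _ * X]E !big_distrr -sumrB -big_split -sumrB big_distrr /=.
  by apply: eq_bigr => d _; rewrite /r; move: d%:R^-1 => x; field.
rewrite normrM (ger0_norm (ler0n _ 2)) ler_wpM2l //.
apply: le_trans (ler_normB _ _) _; apply: lerD.
  apply: le_trans (ler_normD _ _) _; apply: lerD; rewrite normrM ?normrN ler_wpM2l //.
    exact: hC2.
  exact: sum_mobius_div_le.
(* The bound [rb] is summed: [ln (N / d)] and 1 both have sum at most [N], whence [10 + 8 = 18]. *)
apply: le_trans (norm_sum_mobius_le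
  (b := fun d => 10 / N%:R * (L N - L d) + 8 / N%:R * 1) _) _.
  move=> d dN; have dR : (0 : R) < d%:R by rewrite ltr0n; lia.
  rewrite normrM normfV (gtr0_norm dR) ler_pdivrMr //.
  by apply: le_trans (rb d dN) _; rewrite le_eqVlt; apply/orP; left; apply/eqP; ring.
rewrite big_split -!big_distrr /= sum_nat1 divfK ?gt_eqF //.
have -> : (18 : R) = 10 / N%:R * N%:R + 8 by rewrite divfK ?gt_eqF //; ring.
by rewrite lerD2r ler_wpM2l ?sum_ln_ratio // divr_ge0.
Qed.

Definition psi N : R := \sum_(1 <= n < N.+1) Lam n.

Lemma sum_mobius_div_weight N (w : nat -> R) :
  \sum_(1 <= d < N.+1) mu d * (w d * (N %/ d)%:R) =
  \sum_(1 <= n < N.+1) dconv (fun d => mu d * w d) (fun=> 1) n.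
Proof.
by rewrite sum_dconv; apply: eq_bigr => d _; rewrite sum_nat1 mulrA.
Qed.

(** As [ln (N / d) = ln (n / d) + ln (N / n)], the divisor sums of [mu d ln (N / d)] over [n <= N]
    add up to [psi N + ln N]. By [sum_mobius_floor] this is [N] times a bounded sum, up to
    [O(N)]. *)
Lemma psi_le : exists2 C : R, 0 <= C & forall N, psi N <= C * N%:R.
Proof.
have [C hC] := sum_mobius_ln_bounded.
exists (`|C| + 1) => [|N]; first by rewrite addr_ge0.
case: (posnP N) => [->|N0]; first by rewrite /psi big_geq // mulr0.
have NR : (0 : R) < N%:R by rewrite ltr0n.
have Y0 d : (0 < d <= N)%N -> 0 <= L N - L d.
  by move=> /andP[_ dN]; rewrite subr_ge0 ler_lnn.
have := sum_mobius_floor Y0; rewrite sum_mobius_div_weight.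
have -> : \sum_(1 <= n < N.+1) dconv (fun d => mu d * (L N - L d)) (fun=> 1) n =
    psi N + L N.
  transitivity (\sum_(1 <= n < N.+1) (Lam n + ddelta R n * L N)).
    apply: eq_big_nat => n /andP[n0 nN].
    have -> : Lam n = dconv (fun d => mu d * (L n - L d)) (fun=> 1) n.
      rewrite /vonmangoldt !dconv_divE big_nat_cond [RHS]big_nat_cond.
      apply: eq_bigr => d /andP[/andP[d0 _] dn].
      rewrite -{2}(divnK dn) lnnM ?addrK ?mulr1 //.
      by rewrite divn_gt0 // dvdn_leq.
    have -> : ddelta R n * L N = ddelta R n * (L N - L n).
      by rewrite /ddelta; case: eqP => [->|]; rewrite ?mul0r // lnn1 subr0.
    rewrite -mobius_conv // dconvC [X in X + _]dconvC [X in _ + X * _]dconvC.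
    rewrite /dconv big_distrl -big_split /=; apply: eq_bigr => a _.
    by rewrite big_distrl -big_split /=; apply: eq_bigr => b _; ring.
  rewrite big_split /=; congr (_ + _).
  rewrite big_ltn // /ddelta eqxx mul1r big1_seq ?addr0 // => n.
  rewrite mem_index_iota => /andP[_ /andP[n2 _]].
  by case: eqP => [n1|]; [move: n2; rewrite n1|rewrite mul0r].
have := hC N N0; have := sum_ln_ratio R N; have := lnn_ge0 R N.
move: (\sum_(_ <= _ < _) mu _ * _) (\sum_(_ <= _ < _) (_ - _)) => S T l0 TN SC.
rewrite ler_norml => /andP[_ h].
have : N%:R * S <= N%:R * `|C|.
  by rewrite ler_pM2l // (le_trans (ler_norm _)) // (le_trans SC) // ler_norm.
lra.
Qed.

Lemma lnn_sq_le N : L N ^+ 2 <= 3 * N%:R.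
Proof.
case: N => [|N]; first by rewrite /lnn ln0 // expr0n mulr0.
apply: le_trans (sum_ln_ratio2 R N.+1); rewrite big_ltn // lnn1 subr0 lerDl.
by apply: sumr_ge0 => n _; exact: sqr_ge0.
Qed.

(** The argument of [psi_le] with squared logarithms: the divisor sum of [mu d ln^2 (N / d)] is
    [Lam2 n + 2 Lam n ln (N / n)], plus [ln^2 N] at [n = 1]. The middle term has sum [O(N)] by
    Chebyshev's bound, and [sum_mobius_ln2] gives the main term. *)
Lemma sum_selberg : exists2 C : R, 0 <= C & forall N,
  `|\sum_(1 <= n < N.+1) Lam2 n - 2 * N%:R * L N| <= C * N%:R.
Proof.
have [C1 hC1] := sum_mobius_ln2; have [C2 C20 hC2] := psi_le.
exists (`|C1| + 6 + 2 * C2) => [|N]; first by rewrite !addr_ge0 ?mulr_ge0.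
case: (posnP N) => [->|N0].
  by rewrite big_geq // mulr0 mul0r mulr0 subrr normr0.
have NR : (0 : R) < N%:R by rewrite ltr0n.
have := @sum_mobius_floor N (fun d => (L N - L d) ^+ 2) (fun d _ => sqr_ge0 _).
rewrite (sum_mobius_div_weight N (fun d => (L N - L d) ^+ 2)).
have -> : \sum_(1 <= n < N.+1) dconv (fun d => mu d * (L N - L d) ^+ 2) (fun=> 1) n =
    \sum_(1 <= n < N.+1) Lam2 n + 2 * logmean Lam N + L N ^+ 2.
  transitivity (\sum_(1 <= n < N.+1)
      (Lam2 n + 2 * (Lam n * (L N - L n)) + ddelta R n * L N ^+ 2)).
    apply: eq_big_nat => n /andP[n0 nN].
    have -> : ddelta R n * L N ^+ 2 = ddelta R n * (L N - L n) ^+ 2.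
      by rewrite /ddelta; case: eqP => [->|]; rewrite ?mul0r // lnn1 subr0.
    rewrite selbergE // -mobius_conv // /vonmangoldt /dconv.
    rewrite !big_distrl /= big_distrr -!big_split /=; apply: eq_big_nat => a /andP[a0 _].
    rewrite !big_distrl /= big_distrr -!big_split /= big_nat_cond [RHS]big_nat_cond.
    apply: eq_bigr => b /andP[/andP[b0 _] /eqP <-]; rewrite lnnM //; ring.
  rewrite !big_split /= -big_distrr /=; congr (_ + _).
  rewrite big_ltn // /ddelta eqxx mul1r big1_seq ?addr0 // => n.
  rewrite mem_index_iota => /andP[_ /andP[n2 _]].
  by case: eqP => [n1|]; [move: n2; rewrite n1|rewrite mul0r].
have := hC1 N N0; have := sum_ln_ratio2 R N; have := lnn_sq_le N.
have := sqr_ge0 (L N); have := logmean_linear C20 (fun N _ => hC2 N) N.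
have : 0 <= logmean Lam N.
  rewrite /logmean big_nat_cond; apply: sumr_ge0 => n /andP[/andP[_ nN] _].
  by rewrite mulr_ge0 ?vonmangoldt_ge0 // subr_ge0 ler_lnn.
move: (logmean _ _) (\sum_(_ <= _ < _) mu _ * _) (\sum_(_ <= _ < _) (_ - _) ^+ 2).
move: (\sum_(_ <= _ < _) _) (L N ^+ 2) => A l2 T S Q T0 TC l20 lN QN SC.
rewrite !ler_norml => /andP[h1 h2].
have : `|N%:R * (S - 2 * L N)| <= N%:R * `|C1|.
  by rewrite normrM gtr0_norm // ler_pM2l // (le_trans SC) // ler_norm.
rewrite ler_norml => /andP[h3 h4].
apply/andP; split; lra.
Qed.

End Selberg.

(** * Selberg's inequality for the summatory function of [mu] *)

Section MertensInequality.
Variable R : realType.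
Local Notation mu := (mobius R).
Local Notation L := (@lnn R).
Local Notation Lam := (@vonmangoldt R).
Local Notation Lam2 := (@selberg R).
Implicit Types (n N k : nat).

Lemma abel_sum (c h : nat -> R) n :
  \sum_(1 <= k < n.+1) c k * h k =
  (\sum_(1 <= k < n.+1) c k) * h n.+1 +
  \sum_(1 <= k < n.+1) (\sum_(1 <= i < k.+1) c i) * (h k - h k.+1).
Proof.
elim: n => [|n IH]; first by rewrite !big_geq // mul0r addr0.
rewrite big_nat_recr //= IH [in X in _ = _ + X]big_nat_recr //=.
by rewrite ![\sum_(_ <= _ < n.+2) c _]big_nat_recr //=; ring.
Qed.

Definition mertens N : R := \sum_(1 <= n < N.+1) mu n.

Lemma mertensS N : mertens N.+1 = mertens N + mu N.+1.
Proof. by rewrite /mertens big_nat_recr. Qed.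

Lemma mertens_le N : `|mertens N| <= N%:R.
Proof.
apply: le_trans (ler_norm_sum _ _ _) _; rewrite -sum_nat1.
by apply: ler_sum => n _; exact: mobius_norm_le1.
Qed.

(** Writing [|M(N / m)|] as a sum of jumps of [|M|] leaves inner sums of [Lam2] alone, to which
    Selberg's formula applies. *)
Definition mertens_incr n : R := `|mertens n| - `|mertens n.-1|.

Lemma mertens_incr_le n : `|mertens_incr n| <= 1.
Proof.
case: n => [|n]; first by rewrite /mertens_incr subrr normr0 ler01.
apply: le_trans (ler_dist_dist _ _) _; rewrite /= mertensS [mertens n + _]addrC addrK.
exact: mobius_norm_le1.
Qed.

Lemma sum_mertens_incr n : \sum_(1 <= k < n.+1) mertens_incr k = `|mertens n|.
Proof.
rewrite big_add1 /= (telescope_sumr (fun k => `|mertens k|)) //.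
by rewrite [mertens 0]/mertens big_geq // normr0 subr0.
Qed.

(** Split [ln^2 N] as [ln^2 n + (ln N - ln n) (ln N + ln n)]. For the first part use [mobius_lnn2],
    whose factor is at most [Lam2] in absolute value because [Lam] is nonnegative; the second is
    covered by [sum_ln_ratio]. *)
Lemma mertens_lnn2 N : `|mertens N| * L N ^+ 2 <=
  \sum_(1 <= m < N.+1) Lam2 m * `|mertens (N %/ m)| + 2 * N%:R * L N.
Proof.
have -> : `|mertens N| * L N ^+ 2 = `|\sum_(1 <= n < N.+1) mu n * L n ^+ 2 +
   \sum_(1 <= n < N.+1) mu n * ((L N - L n) * (L N + L n))|.
  rewrite -[L N ^+ 2]ger0_norm ?sqr_ge0 // -normrM big_distrl -big_split /=.
  by congr `|_|; apply: eq_bigr => n _; ring.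
apply: le_trans (ler_normD _ _) _; apply: lerD.
  rewrite (eq_big_nat _ _ (F2 := dconv (fun m => dconv Lam Lam m - Lam m * L m) mu)).
    rewrite sum_dconv; apply: le_trans (ler_norm_sum _ _ _) _.
    apply: ler_sum => m _; rewrite normrM ler_wpM2r //.
    have := @dconv_ge0 _ _ _ m (@vonmangoldt_ge0 R) (@vonmangoldt_ge0 R).
    have := mulr_ge0 (vonmangoldt_ge0 R m) (lnn_ge0 R m).
    rewrite /selberg ler_norml => h1 h2; apply/andP; split; lra.
  by move=> n /andP[n0 _]; rewrite mobius_lnn2.
apply: le_trans (norm_sum_mobius_le (b := fun n => 2 * L N * (L N - L n)) _) _.
  move=> n /andP[n0 nN]; have := ler_lnn R nN; have := lnn_ge0 R n.
  move=> h1 h2; rewrite ger0_norm ?mulr_ge0 //; nra.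
rewrite -big_distrr /= [leRHS]mulrAC ler_wpM2l ?sum_ln_ratio // mulr_ge0 //.
exact: lnn_ge0.
Qed.

Lemma sum_selberg_mertens N : \sum_(1 <= m < N.+1) Lam2 m * `|mertens (N %/ m)| =
  \sum_(1 <= k < N.+1) mertens_incr k * \sum_(1 <= m < (N %/ k).+1) Lam2 m.
Proof.
rewrite -sum_dconv; transitivity (\sum_(1 <= n < N.+1) dconv Lam2 mertens_incr n).
  by rewrite sum_dconv; apply: eq_bigr => m _; rewrite sum_mertens_incr.
by apply: eq_bigr => n _; rewrite dconvC.
Qed.

(** With [y = N / k], [j] its floor, [Y = ln y] and [l = ln j], the main terms [2 j l] and [2 y Y]
    differ by at most [2 Y + 2 <= 6 y]. *)
Lemma sum_selberg_divn : exists2 C : R, 0 <= C & forall N k, (0 < k <= N)%N ->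
  `|\sum_(1 <= m < (N %/ k).+1) Lam2 m - 2 * (N%:R / k%:R * (L N - L k))| <=
  C * (N%:R / k%:R).
Proof.
have [C C0 hC] := sum_selberg R; exists (C + 6) => [|N k kN]; first by rewrite addr_ge0.
have k0 : (0 < k)%N by case/andP: kN.
have j0 : (0 < N %/ k)%N by rewrite divn_gt0; lia.
have := hC (N %/ k)%N; have := lnn_divn_bounds R kN; have := lnn_lenat R (N %/ k).
have := lnn_ge0 R (N %/ k).
have := natr_divn_le R N k0; have := natr_divn_gt R N k0.
have j1 : 1 <= (N %/ k)%:R :> R by rewrite ler1n.
have i1 : (N %/ k)%:R^-1 <= 1 :> R by rewrite invf_le1 // ltr0n.
have jV : (N %/ k)%:R * (N %/ k)%:R^-1 = 1 :> R by rewrite divff // pnatr_eq0 -lt0n.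
move: (N%:R / k%:R) (N %/ k)%:R^-1 i1 jV (L N - L k) (L (N %/ k)).
move: (N %/ k)%:R j1 (\sum_(_ <= _ < _) _) => j j1 A y i i1 jV Y l y1 y2 l0 lj /andP[h1 h2].
have X1 : 0 <= (y - j) * Y by rewrite mulr_ge0 //; lra.
have X2 : (y - j) * Y <= 1 * Y by rewrite ler_wpM2r //; lra.
have X3 : 0 <= j * (Y - l) by rewrite mulr_ge0 //; lra.
have X4 : j * (Y - l) <= j * i by rewrite ler_wpM2l //; lra.
have X5 : C * j <= C * y by rewrite ler_wpM2l.
by rewrite !ler_norml => /andP[h3 h4]; apply/andP; split; lra.
Qed.

(** The discrete form of [|M(t)| / t^2], with [1 / k - 1 / (k + 1)] for the measure. *)
Definition mertens_wt k : R := `|mertens k| / (k%:R * k.+1%:R).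

(** [B1] replaces the inner sums by their main terms [2 * h k]; [B2] moves the differences from
    [|M|] to [h] by Abel summation. *)
Lemma mertens_inequality : exists2 C : R, 0 <= C & forall N,
  `|mertens N| * L N ^+ 2 <=
  2 * N%:R * logmean mertens_wt N + C * N%:R * (L N + 1).
Proof.
have [C C0 hC] := sum_selberg_divn; exists (C + 4) => [|N]; first by rewrite addr_ge0.
apply: le_trans (mertens_lnn2 N) _; rewrite sum_selberg_mertens.
pose h k : R := N%:R / k%:R * (L N - L k).
have Hh := harm_le R N; have NR : (0 : R) <= N%:R by [].
have B1 : \sum_(1 <= k < N.+1) mertens_incr k * \sum_(1 <= m < (N %/ k).+1) Lam2 m <=
   2 * (\sum_(1 <= k < N.+1) mertens_incr k * h k) + C * N%:R * (L N + 1).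
  have : \sum_(1 <= k < N.+1) mertens_incr k *
     (\sum_(1 <= m < (N %/ k).+1) Lam2 m - 2 * h k) <= C * N%:R * harm R N.
    rewrite /harm big_distrr /=; apply: ler_sum_nat => k kN.
    apply: le_trans (ler_norm _) _; rewrite normrM -[leRHS]mul1r.
    apply: ler_pM => //; first exact: mertens_incr_le.
    by rewrite -mulrA; exact: hC.
  rewrite (eq_bigr (fun k => mertens_incr k * \sum_(1 <= m < (N %/ k).+1) Lam2 m -
    2 * (mertens_incr k * h k))) => [|k _]; last by ring.
  rewrite sumrB -big_distrr /= => B.
  have : C * N%:R * harm R N <= C * N%:R * (L N + 1) by rewrite ler_wpM2l // mulr_ge0.
  lra.
have B2 : \sum_(1 <= k < N.+1) mertens_incr k * h k <=
   N%:R * logmean mertens_wt N + N%:R * (L N + 1).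
  rewrite abel_sum sum_mertens_incr.
  (* The boundary term is dropped: [h] at [N + 1] contains the nonpositive factor
     [ln N - ln (N + 1)]. *)
  have X : `|mertens N| * h N.+1 <= 0.
    rewrite mulr_ge0_le0 // /h mulr_ge0_le0 ?divr_ge0 //.
    by rewrite subr_le0 ler_lnn.
  apply: le_trans (lerD X (lexx _)) _; rewrite add0r.
  apply: le_trans (_ : N%:R * (logmean mertens_wt N + harm R N) <= _); last first.
    by rewrite mulrDr lerD2l ler_wpM2l.
  rewrite /logmean /harm -big_split big_distrr /=.
  apply: ler_sum_nat => k /andP[k0 kN]; rewrite sum_mertens_incr.
  have kR : (0 : R) < k%:R by rewrite ltr0n.
  have k1R : (0 : R) < k.+1%:R by rewrite ltr0n.
  have hh : h k - h k.+1 <= N%:R * ((L N - L k + 1) / (k%:R * k.+1%:R)).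
    have -> : h k - h k.+1 = N%:R *
      ((L N - L k) / (k%:R * k.+1%:R) + (L k.+1 - L k) / k.+1%:R).
      rewrite /h; have : k.+1%:R = k%:R + 1 :> R by rewrite natr1.
      move: (L k.+1) (L k) kR k1R; move: (k%:R) => x l1 l2 x0 x1 xE.
      by rewrite xE in x1 *; field; rewrite !gt_eqF.
    rewrite ler_wpM2l // [in leRHS]mulrDl lerD2l mul1r invfM.
    by rewrite ler_wpM2r ?invr_ge0 // lnnS_le.
  apply: le_trans (ler_wpM2l (normr_ge0 _) hh) _.
  rewrite /mertens_wt mulrCA ler_wpM2l // mulrDl mulrDr.
  have -> : `|mertens k| * ((L N - L k) / (k%:R * k.+1%:R)) =
     `|mertens k| / (k%:R * k.+1%:R) * (L N - L k) by ring.
  rewrite lerD2l mul1r ler_pdivrMr ?mulr_gt0 // mulrA mulVf ?gt_eqF // mul1r.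
  by apply: le_trans (mertens_le k) _; rewrite ler_nat.
have := mulr_ge0 NR (lnn_ge0 R N).
lra.
Qed.

End MertensInequality.

(** * The estimate [M(x) = o(x)] *)

Section MertensLimit.
Variable R : realType.
Local Notation mu := (mobius R).
Local Notation L := (@lnn R).
Local Notation M := (@mertens R).
Local Notation wt := (@mertens_wt R).
Implicit Types (n N k Y Z : nat).

Ltac clear_real_hyps := repeat match goal with
  | H : is_true (@Order.le _ _ _ _) |- _ => clear H
  | H : is_true (@Order.lt _ _ _ _) |- _ => clear H
  | H : is_true (_ && _) |- _ => case/andP: H => ? ?
  | H : @eq (Real.sort _) _ _ |- _ => clear H
  | H : forall _, _ |- _ => clear H
  end.
Ltac nlia := clear_real_hyps; lia.
Ltac nnia := clear_real_hyps; nia.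

Lemma lnn_unbounded (K : R) : exists2 N, (0 < N)%N & K <= L N.
Proof.
exists (Num.truncn (expR K)).+1 => //.
by rewrite -[X in X <= _]expRK ler_ln ?posrE ?expR_gt0 ?ltr0n // ltW // truncnS_gt.
Qed.

Lemma mertens_wt_ge0 k : 0 <= wt k.
Proof. by rewrite divr_ge0 // mulr_ge0. Qed.

Lemma mertens_wt_le k (s : R) : (0 < k)%N -> `|M k| <= s * k%:R -> wt k <= s / k.+1%:R.
Proof.
move=> k0 Ms; have kR : (0 : R) < k%:R by rewrite ltr0n.
have k1R : (0 : R) < k.+1%:R by rewrite ltr0n.
by rewrite /mertens_wt invfM mulrA ler_wpM2r ?invr_ge0 // ler_pdivrMr.
Qed.

Lemma logmean_wt_le (t B : R) : 0 <= t -> 0 <= B ->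
  (forall N, (0 < N)%N -> \sum_(1 <= k < N.+1) wt k <= t * L N + B) ->
  forall N, logmean wt N <= t / 2 * L N ^+ 2 + B * L N.
Proof.
move=> t0 B0 hB; case=> [|N].
  rewrite logmean0; have := lnn_ge0 R 0; have := sqr_ge0 (L 0).
  by move=> h1 h2; rewrite addr_ge0 ?mulr_ge0 ?divr_ge0.
elim: N => [|N IH]; first by rewrite logmean1 lnn1 expr0n /= !mulr0 addr0.
rewrite logmeanS.
have h := hB N.+1 isT.
have d0 : 0 <= L N.+2 - L N.+1 by rewrite subr_ge0 ler_lnn.
have := ler_wpM2l d0 h; have := mulr_ge0 t0 (sqr_ge0 (L N.+2 - L N.+1)).
nra.
Qed.

(** Integrating the bound halves [t], and the factor 2 of [mertens_inequality] restores it. So a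
    logarithmic mean [t] of the weights bounds [|M(N)| / N] asymptotically by [t], without loss. *)
Lemma mertens_of_wt (t B : R) : 0 <= t -> 0 <= B ->
  (forall N, (0 < N)%N -> \sum_(1 <= k < N.+1) wt k <= t * L N + B) ->
  forall e : R, 0 < e -> exists N0, forall N, (N0 <= N)%N -> `|M N| <= (t + e) * N%:R.
Proof.
move=> t0 B0 hB e e0; have [C C0 hC] := mertens_inequality R.
have [N0 N00 hN0] := lnn_unbounded (1 + (2 * B + 2 * C) / e).
exists N0 => N NN; have lN : 1 + (2 * B + 2 * C) / e <= L N.
  by apply: le_trans hN0 _; exact: ler_lnn.
have D0 : 0 <= (2 * B + 2 * C) / e by apply: divr_ge0; lra.
have l1 : 1 <= L N by lra.
have eL : 2 * B + 2 * C <= e * L N by rewrite [e * _]mulrC -ler_pdivrMr //; lra.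
have L20 : 0 < L N ^+ 2 by rewrite exprn_gt0 //; lra.
rewrite -(ler_pM2r L20); apply: le_trans (hC N) _.
have NR : (0 : R) <= N%:R by [].
have := logmean_wt_le t0 B0 hB N.
move: (L N) (logmean _ _) l1 eL => l m l1 eL hm.
have -> : 2 * N%:R * m + C * N%:R * (l + 1) = N%:R * (2 * m + C * (l + 1)) by ring.
rewrite mulrAC [leRHS]mulrC ler_wpM2l //.
have : (2 * B + 2 * C) * l <= e * l * l by rewrite ler_wpM2r //; lra.
have : C <= C * l by rewrite ler_peMr.
nra.
Qed.

(** Abel summation of [mu k / k], whose sums are bounded by 2, with a boundary term of size at most
    1. *)
Lemma sum_mertens_div_le n : `|\sum_(1 <= k < n.+1) M k / (k%:R * k.+1%:R)| <= 3.
Proof.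
case: n => [|n]; first by rewrite big_geq // normr0.
have := @sum_mobius_div_le R n.+1 isT; rewrite (abel_sum mu (fun k => k%:R^-1)).
rewrite [X in _ + X](eq_big_nat _ _ (F2 := fun k => M k / (k%:R * k.+1%:R))); last first.
  move=> k /andP[k0 _]; rewrite -/(M k); congr (_ * _).
  have kR : (0 : R) < k%:R by rewrite ltr0n.
  have k1R : (0 : R) < k.+1%:R by rewrite ltr0n.
  have : k.+1%:R = k%:R + 1 :> R by rewrite natr1.
  move: k%:R kR k1R => x x0 x1 xE; rewrite xE in x1 *.
  by field; rewrite !gt_eqF.
rewrite -/(M n.+1).
have : `|M n.+1 / n.+2%:R| <= 1.
  rewrite normrM normfV [X in _ / X]ger0_norm // ler_pdivrMr ?ltr0n // mul1r.
  by apply: le_trans (mertens_le R n.+1) _; rewrite ler_nat.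
move: (M n.+1 / _) => z.
rewrite !ler_norml => /andP[h1 h2] /andP[h3 h4]; apply/andP; split; lra.
Qed.

Lemma mertens_intr n : exists z : int, M n = z%:~R.
Proof.
exists (\sum_(1 <= k < n.+1) mobius int k); rewrite rmorph_sum /=.
by apply: eq_bigr => k _; rewrite mobius_intr.
Qed.

(** An integer valued walk with steps at least -1 cannot jump over 0. *)
Lemma mertens_pos_step n : 0 < M n -> M n.+1 <> 0 -> 0 < M n.+1.
Proof.
rewrite mertensS; have [z ->] := mertens_intr n; rewrite mobius_intr ltr0z => z0 nz.
have := mobius_norm_le1 R n.+1; rewrite mobius_intr ler_norml => /andP[h _].
have h' : -1 <= mobius int n.+1 by rewrite -(ler_int R) rmorphN1.
rewrite -rmorphD ltr0z /= in nz *; rewrite lt_def; apply/andP; split; last by lia.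
by apply/eqP => zE; apply: nz; rewrite zE.
Qed.

Lemma mertens_neg_step n : M n < 0 -> M n.+1 <> 0 -> M n.+1 < 0.
Proof.
rewrite mertensS; have [z ->] := mertens_intr n; rewrite mobius_intr ltrz0 => z0 nz.
have := mobius_norm_le1 R n.+1; rewrite mobius_intr ler_norml => /andP[_ h].
have h' : mobius int n.+1 <= 1 by rewrite -(ler_int R).
rewrite -rmorphD ltrz0 /= in nz *; rewrite lt_neqAle; apply/andP; split; last by lia.
by apply/eqP => zE; apply: nz; rewrite zE.
Qed.

Lemma mertens_const_sign Y m : (forall k, (Y < k <= Y + m)%N -> M k <> 0) ->
  (forall k, (Y < k <= Y + m)%N -> 0 < M k) \/
  (forall k, (Y < k <= Y + m)%N -> M k < 0).
Proof.
elim: m => [|m IH] nz; first by left=> k; lia.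
have nz' k : (Y < k <= Y + m)%N -> M k <> 0 by move=> kY; apply: nz; lia.
have nzl : M (Y + m).+1 <> 0 by apply: nz; lia.
have kc k : (Y < k <= Y + m.+1)%N -> (Y < k <= Y + m)%N \/ k = (Y + m).+1 by lia.
case: m {nz} IH nz' nzl kc => [|m] IH nz' nzl kc.
  case: (ltgtP (M (Y + 0).+1) 0) => [h|h|//].
    by right=> k /kc[|->//]; lia.
  by left=> k /kc[|->//]; lia.
have last : (Y < Y + m.+1 <= Y + m.+1)%N by lia.
case: (IH nz') => h; [left|right] => k /kc[/h//|->].
  exact: mertens_pos_step (h _ last) nzl.
exact: mertens_neg_step (h _ last) nzl.
Qed.

(** Without sign changes the absolute values can be taken outside, and the sum is a difference of
    two sums bounded by 3. *)
Lemma sum_wt_const_sign Y Z : (Y <= Z)%N -> (forall k, (Y < k <= Z)%N -> M k <> 0) ->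
  \sum_(Y.+1 <= k < Z.+1) wt k <= 6.
Proof.
move=> YZ nz.
have B : `|\sum_(Y.+1 <= k < Z.+1) M k / (k%:R * k.+1%:R)| <= 6.
  have := sum_mertens_div_le Z; have := sum_mertens_div_le Y.
  rewrite (@big_cat_nat _ _ _ Y.+1 1 Z.+1) //= !ler_norml.
  by move=> /andP[h1 h2] /andP[h3 h4]; apply/andP; split; lra.
have [] : (forall k, (Y < k <= Z)%N -> 0 < M k) \/ (forall k, (Y < k <= Z)%N -> M k < 0).
  by rewrite -(subnKC YZ); apply: mertens_const_sign => k; rewrite subnKC //; exact: nz.
- move=> pos; apply: le_trans B; apply: le_trans (ler_norm _).
  by apply: ler_sum_nat => k /pos h; rewrite /mertens_wt gtr0_norm.
- move=> neg; apply: le_trans B; rewrite -normrN; apply: le_trans (ler_norm _).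
  rewrite -sumrN; apply: ler_sum_nat => k /neg h.
  by rewrite /mertens_wt ltr0_norm // mulNr.
Qed.

Lemma sum_inv_le Y Z : (0 < Y)%N -> (Y <= Z)%N ->
  \sum_(Y.+1 <= k < Z.+1) k.+1%:R^-1 <= L Z - L Y.
Proof.
move=> Y0 YZ; rewrite -(telescope_sumr L) // big_add1 /=.
apply: ler_sum_nat => k /andP[Yk _]; apply: le_trans (lnnS_ge R _); last by lia.
by rewrite lef_pV2 ?posrE ?ltr0n // ler_nat.
Qed.

Lemma sum_wt_le Y Z (s : R) : 0 <= s -> (0 < Y)%N -> (Y <= Z)%N ->
  (forall k, (Y < k)%N -> `|M k| <= s * k%:R) ->
  \sum_(Y.+1 <= k < Z.+1) wt k <= s * (L Z - L Y).
Proof.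
move=> s0 Y0 YZ hs; apply: le_trans (ler_wpM2l s0 (sum_inv_le Y0 YZ)).
rewrite big_distrr /=; apply: ler_sum_nat => k /andP[Yk _].
by apply: mertens_wt_le; [lia|exact: hs].
Qed.

Lemma mertens_lip n j : `|M (n + j)| <= `|M n| + j%:R.
Proof.
elim: j => [|j IH]; first by rewrite addn0 addr0.
rewrite addnS mertensS -natr1 addrA.
by apply: le_trans (ler_normD _ _) _; apply: lerD => //; exact: mobius_norm_le1.
Qed.

(* As [M] has steps at most 1, its zero at [k0] gives [|M k| <= s / 2 * k] for
   [k0 < k <= (1 + s / 2) k0]. *)
Lemma sum_wt_near_zero k0 (s sigma : R) : (0 < k0)%N -> M k0 = 0 ->
  0 < s <= 1 -> s <= sigma -> 4 <= s * k0%:R ->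
  (forall k, (k0 < k)%N -> `|M k| <= sigma * k%:R) ->
  \sum_(k0.+1 <= k < (2 * k0).+1) wt k <= sigma * (L (2 * k0) - L k0) - s ^+ 2 / 24.
Proof.
move=> k00 Mk0 /andP[s0 s1] ss sk hs.
have kR : (0 : R) < k0%:R by rewrite ltr0n.
pose j := Num.truncn (s / 2 * k0%:R).
have e0 : 0 <= s / 2 * k0%:R by apply: mulr_ge0 => //; lra.
have jle : j%:R <= s / 2 * k0%:R by rewrite truncn_le.
have jgt : s / 2 * k0%:R < j.+1%:R by exact: truncnS_gt.
clearbody j.
have jk : (j <= k0)%N by rewrite -(ler_nat R); apply: le_trans jle _; nra.
have jge : s / 4 * k0%:R <= j%:R by move: jgt; rewrite -[j.+1%:R]natr1 => jgt; lra.
have d0 : 0 <= sigma - s / 2 by lra.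
have sg0 : 0 <= sigma by lra.
have zl : (k0 <= 2 * k0)%N by nlia.
have X := ler_wpM2l sg0 (sum_inv_le k00 zl).
rewrite lerBrDr; apply: le_trans X.
rewrite big_distrr /=.
rewrite (@big_cat_nat _ _ _ (k0 + j).+1 k0.+1) /=; [|nlia|nlia].
rewrite [leRHS](@big_cat_nat _ _ _ (k0 + j).+1 k0.+1) /=; [|nlia|nlia].
rewrite addrAC; apply: lerD; last first.
  by apply: ler_sum_nat => k /andP[Yk _]; apply: mertens_wt_le; [nlia|apply: hs; nlia].
(* Each of the [j] terms gains [(s / 2) / (k + 1) >= s / (6 k0)], as [k + 1 <= 3 k0]; and
   [j >= s k0 / 4]. The product is [s^2 / 24]. *)
have Y : \sum_(k0.+1 <= k < (k0 + j).+1) wt k + \sum_(k0.+1 <= k < (k0 + j).+1) (s / (6 * k0%:R))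
   <= \sum_(k0.+1 <= k < (k0 + j).+1) sigma / k.+1%:R.
  rewrite -big_split /=; apply: ler_sum_nat => k /andP[kk kj].
  have k1R : (0 : R) < k.+1%:R by rewrite ltr0n.
  have : wt k <= s / 2 / k.+1%:R.
    apply: mertens_wt_le; first by nlia.
    have -> : k = (k0 + (k - k0))%N by nlia.
    apply: le_trans (mertens_lip _ _) _; rewrite Mk0 normr0 add0r.
    apply: le_trans (_ : j%:R <= _); first by rewrite ler_nat; nlia.
    apply: le_trans jle _; apply: ler_wpM2l; [lra|rewrite ler_nat; nlia].
  have : s / (6 * k0%:R) <= s / 2 / k.+1%:R.
    rewrite -mulrA (ler_wpM2l (ltW s0)) // -invfM lef_pV2 ?posrE ?mulr_gt0 //.
    by rewrite -[2]/(2%:R) -[6]/(6%:R) -!natrM ler_nat; nlia.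
  have : (s / 2 + s / 2) / k.+1%:R <= sigma / k.+1%:R.
    by apply: ler_wpM2r; [rewrite invr_ge0 ltW|lra].
  by move: k.+1%:R^-1 => i h1 h2 h3; lra.
apply: le_trans Y; rewrite lerD2l sumr_const_nat subSS addKn.
rewrite -[leRHS]mulr_natr; have -> : s ^+ 2 / 24 = s / (6 * k0%:R) * (s / 4 * k0%:R).
  by move: k0%:R kR => x x0; field; rewrite gt_eqF.
by rewrite ler_wpM2l // divr_ge0 ?mulr_ge0 // ltW.
Qed.

(** If [M] has no zero in [(Y, KY]], the sum there is at most 6 instead of [sigma ln K >= 7].
    Otherwise a zero [k0] gives the gain on [(k0, 2 k0]], which stays inside the block because its
    end is [2KY]. *)
Lemma sum_wt_block (s sigma : R) Y K : 0 < s <= 1 -> s <= sigma ->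
  (0 < Y)%N -> (0 < K)%N -> 4 <= s * Y%:R -> 7 <= s * L K ->
  (forall k, (Y < k)%N -> `|M k| <= sigma * k%:R) ->
  \sum_(Y.+1 <= k < (Y * (2 * K)).+1) wt k <= sigma * L (2 * K) - s ^+ 2 / 24.
Proof.
move=> s01 ss Y0 K0 sY sK hs; have /andP[s0 s1] := s01.
have sg0 : 0 <= sigma by lra.
have s2 : s ^+ 2 <= 1 by rewrite expr_le1 // ltW.
have LK : s * L K <= sigma * L K by rewrite ler_wpM2r ?lnn_ge0.
have [[k0 /andP[Yk kK] Mk]|nz] :=
    pselect (exists2 k0, (Y < k0 <= Y * K)%N & M k0 = 0); last first.
  rewrite (@big_cat_nat _ _ _ (Y * K).+1 Y.+1) /=; [|nnia|nnia].
  have h1 : \sum_(Y.+1 <= k < (Y * K).+1) wt k <= 6.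
    apply: sum_wt_const_sign; first by nnia.
    by move=> k kY Mk; apply: nz; exists k.
  have h2 : \sum_((Y * K).+1 <= k < (Y * (2 * K)).+1) wt k <=
      sigma * (L (Y * (2 * K)) - L (Y * K)).
    by apply: sum_wt_le => //; [nnia|nnia|move=> k kY; apply: hs; nnia].
  rewrite !lnnM // in h2 *; last by nnia.
  lra.
have hsum : \sum_(Y.+1 <= k < (Y * (2 * K)).+1) wt k =
   \sum_(Y.+1 <= k < k0.+1) wt k + \sum_(k0.+1 <= k < (2 * k0).+1) wt k +
   \sum_((2 * k0).+1 <= k < (Y * (2 * K)).+1) wt k.
  by rewrite -!big_cat_nat //=; nnia.
rewrite hsum.
have h1 : \sum_(Y.+1 <= k < k0.+1) wt k <= sigma * (L k0 - L Y).
  by apply: sum_wt_le => //; exact: ltnW.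
have h2 : \sum_(k0.+1 <= k < (2 * k0).+1) wt k <=
    sigma * (L (2 * k0) - L k0) - s ^+ 2 / 24.
  apply: sum_wt_near_zero => //; first by nlia.
    apply: le_trans sY _; apply: ler_wpM2l; first exact: ltW.
    by rewrite ler_nat ltnW.
  by move=> k kk; apply: hs; nlia.
have h3 : \sum_((2 * k0).+1 <= k < (Y * (2 * K)).+1) wt k <=
    sigma * (L (Y * (2 * K)) - L (2 * k0)).
  by apply: sum_wt_le => //; [nlia|nnia|move=> k kk; apply: hs; nlia].
rewrite (lnnM R Y0 (_ : 0 < 2 * K)%N) in h3; last by nnia.
lra.
Qed.

(** Blocks [(Y Q^i, Y Q^(i+1)]] with [Q = 2K] are chained: a gain of [s^2 / 24] per logarithmic
    length [ln Q] lowers the slope. Rounding [N] up to the end of its block and the sum up to [Y]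
    are absorbed in [B]. *)
Lemma sum_wt_improved (s sigma : R) K Y0 : 0 < s <= 1 -> s <= sigma ->
  (0 < K)%N -> 7 <= s * L K ->
  (forall k, (Y0 <= k)%N -> `|M k| <= sigma * k%:R) ->
  exists2 B : R, 0 <= B & forall N, (0 < N)%N -> \sum_(1 <= k < N.+1) wt k <=
    (sigma - s ^+ 2 / 24 / L (2 * K)) * L N + B.
Proof.
move=> s01 ss K0 sK hs; have /andP[s0 s1] := s01.
pose Y := (Y0 + (Num.truncn (4 / s)).+1)%N.
have Yp : (0 < Y)%N by rewrite /Y; nlia.
have sY : 4 <= s * Y%:R.
  rewrite -ler_pdivrMl // mulrC; apply/ltW/(lt_le_trans (truncnS_gt _)).
  by rewrite ler_nat leq_addl.
have hY k : (Y < k)%N -> `|M k| <= sigma * k%:R.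
  by move=> kY; apply: hs; exact: leq_trans (leq_addr _ _) (ltnW kY).
clearbody Y.
set Q := (2 * K)%N; set t := sigma - _.
have Q2 : (1 < Q)%N by rewrite /Q; nlia.
have LQ : 7 <= L Q.
  have : L K <= L Q by apply: ler_lnn; rewrite /Q; nlia.
  have : s * L K <= 1 * L K by rewrite ler_wpM2r ?lnn_ge0.
  lra.
have t0 : 0 <= t.
  rewrite /t subr_ge0 ler_pdivrMr; last by lra.
  apply: le_trans (_ : sigma * 1 <= _); last by rewrite ler_wpM2l; lra.
  nra.
have tQ : t * L Q = sigma * L Q - s ^+ 2 / 24 by rewrite mulrBl divfK // gt_eqF //; lra.
have B0 : 0 <= \sum_(1 <= k < Y.+1) wt k by apply: sumr_ge0 => k _; exact: mertens_wt_ge0.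
have it i : \sum_(1 <= k < (Y * Q ^ i).+1) wt k <= \sum_(1 <= k < Y.+1) wt k + t * L Q *+ i.
  elim: i => [|i IH]; first by rewrite expn0 muln1 mulr0n addr0.
  have Qi : (0 < Q ^ i)%N by rewrite expn_gt0 ltnW.
  rewrite (@big_cat_nat _ _ _ (Y * Q ^ i).+1 1) //=; last by rewrite expnS; nnia.
  rewrite mulrS addrCA addrC; apply: lerD => //.
  rewrite tQ expnSr mulnA; apply: sum_wt_block => //; first by nnia.
    apply: le_trans sY _; apply: ler_wpM2l; [exact: ltW|rewrite ler_nat; nnia].
  by move=> k kk; apply: hY; nnia.
exists (\sum_(1 <= k < Y.+1) wt k + t * L Q) => [|N N0].
  by rewrite addr_ge0 // mulr_ge0 //; lra.
have mono a b : (a <= b)%N -> \sum_(1 <= k < a.+1) wt k <= \sum_(1 <= k < b.+1) wt k.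
  move=> ab; rewrite [leRHS](@big_cat_nat _ _ _ a.+1 1) //= lerDl.
  by apply: sumr_ge0 => k _; exact: mertens_wt_ge0.
have [NY|YN] := leqP N Y.
  apply: le_trans (mono _ _ NY) _.
  have : 0 <= t * L N by rewrite mulr_ge0 ?lnn_ge0.
  have : 0 <= t * L Q by rewrite mulr_ge0 ?lnn_ge0.
  lra.
have NY0 : (0 < N %/ Y)%N by rewrite divn_gt0 // ltnW.
have /andP[b1 b2] := trunc_log_bounds Q2 NY0.
set i := trunc_log Q (N %/ Y) in b1 b2.
have Ni : (N <= Y * Q ^ i.+1)%N.
  by rewrite ltnW // (leq_trans (ltn_ceil N Yp)) // mulnC leq_mul2l b2 orbT.
apply: le_trans (mono _ _ Ni) _; apply: le_trans (it _) _.
have Qi : (0 < Q ^ i)%N by rewrite expn_gt0 ltnW.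
have Li : L Q *+ i <= L N.
  have -> : L Q *+ i = L (Q ^ i).
    by rewrite /lnn natrX lnXn // ltr0n ltnW.
  by apply: ler_lnn; apply: leq_trans b1 _; exact: leq_div.
have := ler_wpM2l t0 Li; rewrite mulrnAr mulrSr.
by move: (_ *+ i) => z h; lra.
Qed.

(** [inf A] is the upper limit [s] of [|M(N)| / N]. If [s > 0], the gain [d] depends on [s] and [K]
    only, so a [sigma] in [A] below [s + d / 4] can be improved to [sigma - d / 2 < s]. *)
Theorem mertens_little_o (e : R) : 0 < e ->
  exists N0, forall N, (N0 <= N)%N -> `|M N| <= e * N%:R.
Proof.
pose A : set R := [set x | 0 <= x /\
   exists N0, forall N, (N0 <= N)%N -> `|M N| <= x * N%:R].
have A1 : A 1 by split=> //; exists 0%N => N _; rewrite mul1r; exact: mertens_le.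
have Alb : lbound A 0 by move=> x [].
have iA : has_inf A by split; [exists 1|exists 0].
have s0 : 0 <= inf A by apply: lb_le_inf => //; exists 1.
have s1 : inf A <= 1 by apply: ge_inf => //; exists 0.
move=> e0; suff sz : inf A = 0.
  have [x [x0 [N0 hN0]] xe] := inf_adherent e0 iA.
  exists N0 => N NN; apply: le_trans (hN0 N NN) _.
  by rewrite ler_wpM2r // ltW // -[e]add0r -sz.
apply/eqP; rewrite eq_le s0 andbT leNgt; apply/negP => sp.
set s := inf A in s0 s1 sp.
have [K K0 hK] := lnn_unbounded (7 / s).
have sK : 7 <= s * L K by rewrite mulrC -ler_pdivrMr.
have LQ : 0 < L (2 * K).
  have : L K <= L (2 * K) by apply: ler_lnn; nlia.
  have : 0 < 7 / s by rewrite divr_gt0.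
  lra.
pose d := s ^+ 2 / 24 / L (2 * K).
have d0 : 0 < d by rewrite /d divr_gt0 // divr_gt0 // exprn_gt0.
have d4 : 0 < d / 4 by rewrite divr_gt0.
have [sigma Asig sigma_lt] := inf_adherent d4 iA.
have sle : s <= sigma by apply: ge_inf => //; exists 0.
have [sig0 [Y0 hY0]] := Asig.
have s01 : 0 < s <= 1 by rewrite sp.
have [B B0 hB] := sum_wt_improved s01 sle K0 sK hY0.
have t0 : 0 <= sigma - d.
  rewrite subr_ge0; apply: le_trans sle; rewrite /d ler_pdivrMr //.
  have : s * L K <= s * L (2 * K) by rewrite ler_wpM2l //; apply: ler_lnn; nlia.
  have : s ^+ 2 <= 1 by rewrite expr_le1.
  lra.
have d2 : 0 < d / 2 by rewrite divr_gt0.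
have [N0 hN0] := mertens_of_wt t0 B0 hB d2.
have : A (sigma - d + d / 2) by split; [lra|exists N0].
by move=> /(ge_inf (ex_intro _ _ Alb)); rewrite -/s; lra.
Qed.

End MertensLimit.

(** * Euler products and the sieve of Eratosthenes-Legendre *)

Section Sieve.
Variable R : realType.
Variable P : pred nat.
Hypothesis HP : forall p, P p -> prime p.
Implicit Types (n N y p : nat).

Definition trunc_pred y : pred nat := fun p => P p && (p <= y)%N.

Lemma euler_partialS y : euler_partial R P y.+1 =
  euler_partial R P y * (if P y.+1 then 1 - y.+1%:R^-1 else 1).
Proof. by rewrite /euler_partial [LHS]big_mkcond big_nat_recr //= -big_mkcond. Qed.

Lemma recip_partialS y : recip_partial R P y.+1 =
  recip_partial R P y + (if P y.+1 then y.+1%:R^-1 else 0).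
Proof. by rewrite /recip_partial [LHS]big_mkcond big_nat_recr //= -big_mkcond. Qed.

Lemma notP0 : P 0 = false.
Proof. by apply/negbTE/negP => /HP. Qed.

Lemma euler_partial0 : euler_partial R P 0 = 1.
Proof. by rewrite /euler_partial big_mkcond big_nat1 notP0. Qed.

Lemma recip_partial0 : recip_partial R P 0 = 0.
Proof. by rewrite /recip_partial big_mkcond big_nat1 notP0. Qed.

Lemma inv_prime_bounds p : prime p -> 0 < (p%:R^-1 : R) <= 2^-1.
Proof.
move=> pp; rewrite invr_gt0 ltr0n prime_gt0 //=.
by rewrite lef_pV2 ?posrE ?ltr0n ?prime_gt0 // (ler_nat R 2) prime_gt1.
Qed.

Lemma euler_partial_gt0 y : 0 < euler_partial R P y.
Proof.
elim: y => [|y IH]; first by rewrite euler_partial0.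
rewrite euler_partialS mulr_gt0 //; case: ifP => // /HP /inv_prime_bounds.
by move: y.+1%:R^-1 => a /andP[h1 h2]; lra.
Qed.

Lemma euler_partial_noninc : {homo euler_partial R P : n m / (n <= m)%N >-> m <= n}.
Proof.
apply/nonincreasing_seqP => y; rewrite euler_partialS ler_piMr //.
  exact/ltW/euler_partial_gt0.
by case: ifP.
Qed.

Lemma recip_partial_nondec : {homo recip_partial R P : n m / (n <= m)%N >-> n <= m}.
Proof.
apply/nondecreasing_seqP => y; rewrite recip_partialS lerDl.
by case: ifP => // _; rewrite invr_ge0.
Qed.

Lemma euler_partial_le_exp y : euler_partial R P y <= expR (- recip_partial R P y).
Proof.
elim: y => [|y IH]; first by rewrite euler_partial0 recip_partial0 oppr0 expR0.
rewrite euler_partialS recip_partialS; case: ifP => [/HP/inv_prime_bounds|_].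
  move: y.+1%:R^-1 => a /andP[h1 h2]; rewrite opprD expRD.
  apply: ler_pM => //; [exact/ltW/euler_partial_gt0|lra|exact: expR_ge1Dx].
by rewrite addr0 mulr1.
Qed.

(** For [0 < a <= 1 / 2], [1 / (1 - a) <= 1 + 2 a <= expR (2 a)]; reciprocals of primes are in this
    range. *)
Lemma euler_partial_ge_exp y :
  expR (- (2 * recip_partial R P y)) <= euler_partial R P y.
Proof.
elim: y => [|y IH]; first by rewrite euler_partial0 recip_partial0 mulr0 oppr0 expR0.
rewrite euler_partialS recip_partialS; case: ifP => [/HP/inv_prime_bounds|_].
  move: y.+1%:R^-1 => a /andP[h1 h2]; rewrite mulrDr opprD expRD.
  apply: ler_pM; rewrite ?expR_ge0 // expRN.
  have a1 : 0 < 1 - a by lra.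
  rewrite -[leRHS]invrK lef_pV2 ?posrE ?invr_gt0 ?expR_gt0 //.
  apply: le_trans (expR_ge1Dx _).
  rewrite -[leLHS]mul1r ler_pdivrMr //; nra.
by rewrite addr0 mulr1.
Qed.

Lemma nofactor_primeM (S : pred nat) p c : prime p -> (0 < c)%N ->
  nofactor S (p * c) = ~~ S p && nofactor S c.
Proof.
move=> pp c0; rewrite /nofactor -negb_or; congr (~~ _).
apply/hasP/orP => [[q]|].
  rewrite primesM ?(prime_gt0 pp) // primes_prime // inE => /orP[/eqP->|qc] Sq; [by left|right].
  by apply/hasP; exists q.
case=> [Sp|/hasP[q qc Sq]]; [exists p|exists q] => //.
  by rewrite primesM ?(prime_gt0 pp) // primes_prime // inE eqxx.
by rewrite primesM ?(prime_gt0 pp) // qc orbT.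
Qed.

Lemma nofactor_truncS y n : (0 < n)%N -> nofactor (trunc_pred y.+1) n =
  nofactor (trunc_pred y) n && ~~ (P y.+1 && (y.+1 %| n)%N).
Proof.
move=> n0; rewrite /nofactor -negb_or; congr (~~ _).
apply/hasP/orP => [[q qn /andP[Pq qy]]|].
  move: qy; rewrite leq_eqVlt => /orP[/eqP qE|qy].
    by right; rewrite -qE Pq; move: qn; rewrite mem_primes => /and3P[].
  by left; apply/hasP; exists q => //; rewrite /trunc_pred Pq.
case=> [/hasP[q qn /andP[Pq qy]]|/andP[Py yn]].
  by exists q => //; rewrite /trunc_pred Pq ltnW.
by exists y.+1; rewrite ?/trunc_pred ?Py ?leqnn // mem_primes HP // n0.
Qed.

Definition sieve_count (S : pred nat) N : R :=
  \sum_(1 <= n < N.+1) (nofactor S n)%:R.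

(** Legendre's recursion: the integers removed at a prime [p = y + 1] are the [p * c] with [c] a
    survivor of the earlier steps. *)
Lemma sieve_countS y N : sieve_count (trunc_pred y.+1) N =
  sieve_count (trunc_pred y) N -
  (if P y.+1 then sieve_count (trunc_pred y) (N %/ y.+1) else 0).
Proof.
rewrite /sieve_count (eq_big_nat _ _ (F2 := fun n => (nofactor (trunc_pred y) n &&
  ~~ (P y.+1 && (y.+1 %| n)%N))%:R)); last first.
  by move=> n /andP[n0 _]; rewrite nofactor_truncS.
case: ifP => [Py|_]; last by rewrite subr0; apply: eq_bigr => n _; rewrite andbT.
have pp := HP Py.
have -> : \sum_(1 <= n < (N %/ y.+1).+1) (nofactor (trunc_pred y) n)%:R =
  \sum_(1 <= n < N.+1) ((y.+1 %| n)%N && nofactor (trunc_pred y) n)%:R :> R.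
  rewrite [RHS](eq_bigr (fun n => if (y.+1 %| n)%N && xpredT n then
     (nofactor (trunc_pred y) n)%:R else 0)); last first.
    by move=> n _; rewrite andbT; case: (y.+1 %| n)%N.
  rewrite -big_mkcond /= sum_multiples //; apply: eq_big_nat => n /andP[n0 _].
  by rewrite nofactor_primeM // /trunc_pred ltnn andbF.
rewrite -sumrB; apply: eq_bigr => n _ /=.
by case: (nofactor _ n); case: (y.+1 %| n)%N => /=; rewrite ?subr0 ?subrr.
Qed.

(** Each sieving prime turns the error [C] into at most [2 C + 1]. This grows fast with [y] but is
    uniform in [N]. *)
Lemma sieve_count_approx y : exists2 C : R, 0 <= C & forall N,
  `|sieve_count (trunc_pred y) N - N%:R * euler_partial R P y| <= C.
Proof.
elim: y => [|y [C C0 IH]].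
  exists 0 => // N; rewrite euler_partial0 mulr1 /sieve_count.
  rewrite (eq_bigr (fun=> 1)) ?sum_nat1 ?subrr ?normr0 // => n _.
  rewrite (_ : nofactor _ _ = true) //; apply/hasPn => q _.
  by rewrite /trunc_pred leqn0; case: eqP => [->|_]; rewrite ?andbF // notP0.
exists (C + C + 1) => [|N]; first by rewrite !addr_ge0.
rewrite sieve_countS euler_partialS; case: ifP => [_|_]; last first.
  by rewrite subr0 mulr1; have := IH N; lra.
have y0 : (0 < y.+1)%N by [].
have := IH N; have := IH (N %/ y.+1)%N.
have := natr_divn_le R N y0; have := natr_divn_gt R N y0.
have e1 : euler_partial R P y <= 1 by rewrite -euler_partial0; exact: euler_partial_noninc.
have e0 := ltW (euler_partial_gt0 y).
move: y.+1%:R^-1 (sieve_count _ N) (sieve_count _ _) => i a b.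
move: (euler_partial R P y) e0 e1 ((N %/ y.+1)%:R) (N%:R) => e e0 e1 k x h1 h2.
have X1 : 0 <= (x * i - k) * e by rewrite mulr_ge0 //; lra.
have X2 : (x * i - k) * e <= 1 * 1 by apply: ler_pM => //; lra.
rewrite !ler_norml => /andP[h3 h4] /andP[h5 h6]; apply/andP; split; lra.
Qed.

Lemma nofactor_trunc y n : nofactor P n -> nofactor (trunc_pred y) n.
Proof.
by apply: contra => /hasP[q qn /andP[Pq _]]; apply/hasP; exists q.
Qed.

Lemma sieve_count_le y N : sieve_count P N <= sieve_count (trunc_pred y) N.
Proof.
apply: ler_sum => n _; case: (boolP (nofactor P n)) => [/(nofactor_trunc y)->//|_].
by rewrite ler0n.
Qed.

(** A survivor of the truncated sieve that [P] removes has a prime factor [q] in [P] with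
    [y < q <= N], and at most [N / q] integers are multiples of [q]. *)
Lemma sieve_count_ge y N : (y <= N)%N -> sieve_count (trunc_pred y) N -
  N%:R * (recip_partial R P N - recip_partial R P y) <= sieve_count P N.
Proof.
move=> yN; have -> : recip_partial R P N - recip_partial R P y =
    \sum_(y.+1 <= p < N.+1 | P p) p%:R^-1.
  by rewrite /recip_partial (@big_cat_nat _ _ _ y.+1 0 N.+1) //= addrAC subrr add0r.
rewrite lerBlDr.
apply: le_trans (_ : sieve_count P N +
   \sum_(y.+1 <= p < N.+1 | P p) \sum_(1 <= n < N.+1) ((p %| n)%N)%:R <= _); last first.
  rewrite lerD2l big_distrr /= big_nat_cond [leRHS]big_nat_cond.
  apply: ler_sum => p /andP[/andP[yp _] _]; have p0 : (0 < p)%N by lia.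
  apply: le_trans (natr_divn_le R N p0).
  rewrite (eq_bigr (fun n => if (p %| n)%N && xpredT n then 1 else 0)); last first.
    by move=> n _; rewrite andbT; case: (p %| n)%N.
  by rewrite -big_mkcond /= sum_multiples // sum_nat1.
rewrite exchange_big /= /sieve_count -big_split /=.
apply: ler_sum_nat => n /andP[n0 nN].
have S0 : (0 : R) <= \sum_(y.+1 <= p < N.+1 | P p) ((p %| n)%N)%:R by apply: sumr_ge0.
case: (boolP (nofactor P n)) => [/(nofactor_trunc y)->|]; first by rewrite lerDl.
case: (boolP (nofactor (trunc_pred y) n)) => [/hasPn nt|_ _]; last by rewrite add0r.
rewrite negbK => /hasP[q qn Pq]; rewrite add0r.
have yq : (y < q)%N by have := nt q qn; rewrite /trunc_pred Pq /= -ltnNge.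
move: qn; rewrite mem_primes => /and3P[_ _ qn].
have qN : (q < N.+1)%N by apply: leq_trans nN; rewrite ltnS; exact: dvdn_leq.
rewrite big_mkcond (bigD1_seq q) /= ?mem_index_iota ?iota_uniq ?yq //=.
by rewrite Pq qn lerDl; apply: sumr_ge0 => i _; case: ifP.
Qed.

Lemma sieve_count_ge0 (S : pred nat) N : 0 <= sieve_count S N.
Proof. exact: sumr_ge0. Qed.

End Sieve.

(** * Density of the integers without prime factors in [P] *)

Section Density.
Variable R : realType.
Implicit Types (P : pred nat) (e : R).

Lemma nondecreasing_tail (u : nat -> R) (B : R) :
  {homo u : n m / (n <= m)%N >-> n <= m} -> (forall n, u n <= B) ->
  forall e, 0 < e -> exists D, forall N, u N - u D <= e.
Proof.
move=> ui uB e e0; have sA : has_sup (range u).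
  by split; [exists (u 0%N), 0%N|exists B => _ [n _ <-]].
have [_ [D _ <-] hD] := sup_adherent e0 sA.
exists D => N; have : u N <= sup (range u) by apply: ub_le_sup; [case: sA|exists N].
lra.
Qed.

Lemma euler_cvg P : (forall p, P p -> prime p) -> cvgn (euler_partial R P).
Proof.
move=> HP; apply: nonincreasing_is_cvgn; first exact: euler_partial_noninc.
by exists 0 => _ [n _ <-]; exact/ltW/euler_partial_gt0.
Qed.

Lemma euler_lim_le P y : (forall p, P p -> prime p) ->
  limn (euler_partial R P) <= euler_partial R P y.
Proof.
move=> HP; apply: nonincreasing_cvgn_ge; last exact: euler_cvg.
exact: euler_partial_noninc.
Qed.

Lemma euler_lim_ge0 P : (forall p, P p -> prime p) -> 0 <= limn (euler_partial R P).
Proof.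
move=> HP; apply: limr_ge; first exact: euler_cvg.
by apply: nearW => n; exact/ltW/euler_partial_gt0.
Qed.

Lemma euler_lim_near P e : (forall p, P p -> prime p) -> 0 < e ->
  exists y, euler_partial R P y <= limn (euler_partial R P) + e.
Proof.
move=> HP e0; have /cvgrPdist_le /(_ e e0) [y _ hy] := euler_cvg HP.
by exists y; have := hy y (leqnn y); rewrite /= ler_norml => /andP[h1 h2]; lra.
Qed.

Lemma euler_lim_recip_bounded P (B : R) : (forall p, P p -> prime p) ->
  (forall N, recip_partial R P N <= B) -> 0 < limn (euler_partial R P).
Proof.
move=> HP hB; apply: lt_le_trans (expR_gt0 (- (2 * B))) _.
apply: limr_ge; first exact: euler_cvg.
apply: nearW => n; apply: le_trans (euler_partial_ge_exp R HP n).
by rewrite ler_expR lerN2 ler_wpM2l.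
Qed.

Lemma euler_lim_recip_unbounded P : (forall p, P p -> prime p) ->
  ~ (exists B : R, forall N, recip_partial R P N <= B) ->
  limn (euler_partial R P) = 0.
Proof.
move=> HP nb; apply/eqP; rewrite eq_le euler_lim_ge0 // andbT leNgt; apply/negP => l0.
apply: nb; exists (- ln (limn (euler_partial R P))) => N.
rewrite lerNr -ler_expR lnK ?posrE //.
exact: le_trans (euler_lim_le N HP) (euler_partial_le_exp R HP N).
Qed.

(** The truncated sieve always bounds the count from above. From below, either the reciprocals have
    bounded sums and the primes beyond [y] remove few integers, or the limit is 0 and nonnegativity
    of the count suffices. *)
Lemma sieve_density P : (forall p, P p -> prime p) -> forall e : R, 0 < e ->
  exists N0, forall N, (N0 <= N)%N ->
  `|sieve_count R P N - N%:R * limn (euler_partial R P)| <= e * N%:R.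
Proof.
move=> HP e e0; set l := limn _.
have e2 : 0 < e / 2 by rewrite divr_gt0.
have [y1 hy1] := euler_lim_near HP e2.
have upper : exists N0, forall N, (N0 <= N)%N ->
    sieve_count R P N - N%:R * l <= e * N%:R.
  have [C C0 hC] := sieve_count_approx R HP y1.
  exists (Num.truncn (C / (e / 2))).+1 => N NN.
  have NC : C <= e / 2 * N%:R.
    rewrite mulrC -ler_pdivrMr //; apply/ltW/(lt_le_trans (truncnS_gt _)).
    by rewrite ler_nat.
  have := hC N; have := sieve_count_le R P y1 N; rewrite ler_norml => h1 /andP[_ h2].
  have : N%:R * euler_partial R P y1 <= N%:R * (l + e / 2) by rewrite ler_wpM2l.
  lra.
have lower : exists N0, forall N, (N0 <= N)%N ->
    - (e * N%:R) <= sieve_count R P N - N%:R * l.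
  have [[B hB]|nb] := pselect (exists B : R, forall N, recip_partial R P N <= B); last first.
    exists 0%N => N _; rewrite /l euler_lim_recip_unbounded // mulr0 subr0.
    apply: le_trans (sieve_count_ge0 R P N); rewrite oppr_le0.
    by rewrite mulr_ge0 // ltW.
  have [y hy] := nondecreasing_tail (recip_partial_nondec R P) hB e2.
  have [C C0 hC] := sieve_count_approx R HP y.
  exists (maxn y (Num.truncn (C / (e / 2))).+1) => N; rewrite geq_max => /andP[yN NN].
  have NC : C <= e / 2 * N%:R.
    rewrite mulrC -ler_pdivrMr //; apply/ltW/(lt_le_trans (truncnS_gt _)).
    by rewrite ler_nat.
  have := hC N; have := sieve_count_ge R P yN; rewrite ler_norml => h1 /andP[h2 _].
  have h3 : N%:R * l <= N%:R * euler_partial R P y by rewrite ler_wpM2l // euler_lim_le.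
  have h4 : N%:R * (recip_partial R P N - recip_partial R P y) <= N%:R * (e / 2).
    by rewrite ler_wpM2l.
  lra.
have [N1 h1] := upper; have [N2 h2] := lower.
exists (maxn N1 N2) => N; rewrite geq_max => /andP[n1 n2].
by rewrite ler_norml h1 // h2.
Qed.

End Density.

(** * The summatory function of [mu] restricted to smooth integers *)

Section SmoothMertens.
Variable R : realType.
Variable P : pred nat.
Hypothesis HP : forall p, P p -> prime p.
Local Notation M := (@mertens R).
Implicit Types (n N d : nat).

Definition prime_compl : pred nat := fun p => prime p && ~~ P p.

Lemma prime_complP p : prime_compl p -> prime p.
Proof. by case/andP. Qed.

Lemma Psmooth_compl n : (0 < n)%N -> Psmooth P n = nofactor prime_compl n.
Proof.
move=> n0; rewrite /Psmooth /nofactor n0 -all_predC; apply: eq_in_all => q.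
by rewrite mem_primes => /and3P[qp _ _]; rewrite /= /prime_compl qp negbK.
Qed.

Lemma nofactor_compl n : (0 < n)%N -> nofactor P n = Psmooth prime_compl n.
Proof.
move=> n0; rewrite /Psmooth /nofactor n0 -all_predC; apply: eq_in_all => q.
by rewrite mem_primes => /and3P[qp _ _]; rewrite /= /prime_compl qp.
Qed.

Definition mertensP N : R := \sum_(1 <= n < N.+1) mobiusP R P n.

Lemma mertensP_le_count N : `|mertensP N| <= sieve_count R prime_compl N.
Proof.
apply: le_trans (ler_norm_sum _ _ _) _; apply: ler_sum_nat => n /andP[n0 _].
rewrite /mobiusP Psmooth_compl //; case: ifP => _; last by rewrite normr0.
exact: mobius_norm_le1.
Qed.

Lemma mertensP_conv N : mertensP N =
  \sum_(1 <= d < N.+1) (Psmooth prime_compl d)%:R * M (N %/ d).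
Proof.
rewrite -sum_dconv; apply: eq_big_nat => n /andP[n0 _].
apply: mobius_inversion => // i i0; rewrite mobiusP_conv //.
by rewrite nofactor_compl.
Qed.

End SmoothMertens.

(** * Reciprocal sums of smooth integers *)

Section SmoothSum.
Variable R : realType.
Variable Q : pred nat.
Hypothesis HQ : forall p, Q p -> prime p.
Implicit Types (n N d y : nat).

Definition smooth_sum (S : pred nat) N : R :=
  \sum_(1 <= d < N.+1) (Psmooth S d)%:R / d%:R.

Lemma smooth_sum_nondec S : {homo smooth_sum S : n m / (n <= m)%N >-> n <= m}.
Proof.
apply/nondecreasing_seqP => n; rewrite /smooth_sum [leRHS]big_nat_recr //= lerDl.
by rewrite divr_ge0.
Qed.

Lemma Psmooth_truncS y d : (0 < d)%N -> ~~ (Q y.+1 && (y.+1 %| d)%N) ->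
  Psmooth (trunc_pred Q y.+1) d = Psmooth (trunc_pred Q y) d.
Proof.
move=> d0 nd; rewrite /Psmooth d0; apply: eq_in_all => q.
rewrite mem_primes => /and3P[_ _ qd]; rewrite /trunc_pred leq_eqVlt ltnS.
case: eqP => [qE|//]; rewrite qE ltnn andbF andbT.
by apply/negbTE; move: nd; apply: contra => Qy; rewrite Qy -qE qd.
Qed.

(* For a prime [p = y + 1] in [Q], splitting off the multiples of [p] gives
   [S_(y+1) N = S_y N + S_(y+1) (N / p) / p], and [S_(y+1) (N / p) <= S_(y+1) N]. *)
Lemma smooth_sum_truncS y N : smooth_sum (trunc_pred Q y.+1) N *
  (if Q y.+1 then 1 - y.+1%:R^-1 else 1) <= smooth_sum (trunc_pred Q y) N.
Proof.
case: ifP => [Qy|nQ]; last first.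
  rewrite mulr1; apply: ler_sum_nat => d /andP[d0 _].
  by rewrite Psmooth_truncS ?nQ.
have pp := HQ Qy.
rewrite mulrBr mulr1 lerBlDr.
rewrite {1}/smooth_sum (bigID (fun d => (y.+1 %| d)%N)) /= addrC; apply: lerD.
  rewrite /smooth_sum big_mkcond /=; apply: ler_sum_nat => d /andP[d0 _].
  case: ifP => [nd|_]; last by rewrite divr_ge0.
  by rewrite Psmooth_truncS // negb_and nd orbT.
rewrite (eq_bigl (fun d => (y.+1 %| d)%N && xpredT d)) => [|d]; last by rewrite andbT.
rewrite sum_multiples //.
apply: le_trans (_ : smooth_sum (trunc_pred Q y.+1) (N %/ y.+1) / y.+1%:R <= _); last first.
  by rewrite ler_wpM2r ?invr_ge0 // smooth_sum_nondec // leq_div.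
rewrite /smooth_sum big_distrl /=; apply: ler_sum_nat => c /andP[c0 _].
rewrite Psmooth_primeM // /trunc_pred Qy leqnn /=.
by rewrite natrM invfM mulrA mulrAC.
Qed.

(** Induction on [y] takes in one Euler factor at a time; for [y = 0] the only smooth integer is
    1. *)
Lemma smooth_sum_trunc y N : smooth_sum (trunc_pred Q y) N * euler_partial R Q y <= 1.
Proof.
elim: y => [|y IH].
  rewrite euler_partial0 // mulr1 /smooth_sum; case: N => [|N]; first by rewrite big_geq.
  rewrite big_ltn // divr1 big1_seq ?addr0 // => d.
  rewrite mem_index_iota => /andP[_ /andP[d1 _]].
  rewrite (_ : Psmooth _ _ = false) ?mul0r //; apply/negbTE/negP => /andP[d0 /allP H].
  have := H (pdiv d); rewrite mem_primes pdiv_prime // d0 pdiv_dvd => /(_ isT).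
  by rewrite /trunc_pred leqn0 => /andP[_ /eqP p0]; have := pdiv_gt0 d; rewrite p0.
rewrite euler_partialS mulrCA mulrC; apply: le_trans IH.
by rewrite ler_wpM2r ?smooth_sum_truncS // ltW // euler_partial_gt0.
Qed.

Lemma smooth_sum_le N : smooth_sum Q N <= expR (2 * recip_partial R Q N).
Proof.
have -> : smooth_sum Q N = smooth_sum (trunc_pred Q N) N.
  apply: eq_big_nat => d /andP[d0 dN]; congr ((_ : bool)%:R / _).
  rewrite /Psmooth d0; apply: eq_in_all => q; rewrite mem_primes => /and3P[_ _ qd].
  by rewrite /trunc_pred (leq_trans (dvdn_leq d0 qd)) ?andbT.
have e0 := euler_partial_gt0 R HQ N.
apply: le_trans (_ : (euler_partial R Q N)^-1 <= _).
  by rewrite -[leRHS]mul1r ler_pdivlMr // smooth_sum_trunc.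
rewrite -[leRHS]invrK -expRN lef_pV2 ?posrE ?expR_gt0 //.
exact: euler_partial_ge_exp.
Qed.

End SmoothSum.

(** * Axer's theorem and convergence of the series *)

Section Conclusion.
Variable R : realType.
Implicit Types (P : pred nat) (e : R) (N n : nat).

(** When the reciprocals of [Q] have bounded sums, the convolution is cut at [D]: for [d <= D] the
    estimate [M(x) = o(x)] applies at [N / d], and for [d > D] the trivial bound [N / d] meets a
    small tail. *)
Lemma mertensP_little_o P : (forall p, P p -> prime p) -> forall e, 0 < e ->
  exists N0, forall N, (N0 <= N)%N -> `|mertensP R P N| <= e * N%:R.
Proof.
move=> HP e e0; pose Q := prime_compl P; have HQ := @prime_complP P.
have [[B hB]|nb] := pselect (exists B : R, forall N, recip_partial R Q N <= B); last first.
  have [N0 hN0] := sieve_density HQ e0; exists N0 => N NN.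
  apply: le_trans (mertensP_le_count R P N) _; have := hN0 N NN.
  rewrite euler_lim_recip_unbounded // mulr0 subr0.
  exact: le_trans (ler_norm _).
have sB N : smooth_sum R Q N <= expR (2 * B).
  by apply: le_trans (smooth_sum_le R HQ N) _; rewrite ler_expR ler_wpM2l.
have e2 : 0 < e / 2 by rewrite divr_gt0.
have [D hD] := nondecreasing_tail (smooth_sum_nondec R Q) sB e2.
have T0 : 0 < expR (2 * B) by exact: expR_gt0.
pose e' := e / 2 / expR (2 * B).
have e'0 : 0 < e' by rewrite divr_gt0.
have [N0 hN0] := mertens_little_o e'0.
(* This makes [N %/ d >= N0] for all [d <= D], and places the cut [D] below [N]. *)
exists (D + D * N0)%N => N NN; rewrite mertensP_conv -/Q.
have DN : (D < N.+1)%N by rewrite ltnS (leq_trans (leq_addr _ _) NN).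
rewrite (@big_cat_nat _ _ _ D.+1 1 N.+1) //=.
apply: le_trans (ler_normD _ _) _; rewrite (splitr e) mulrDl; apply: lerD.
  apply: le_trans (ler_norm_sum _ _ _) _.
  apply: le_trans (_ : e' * N%:R * smooth_sum R Q D <= _); last first.
    apply: le_trans (_ : e' * N%:R * expR (2 * B) <= _).
      by rewrite ler_wpM2l // mulr_ge0 // ltW.
    by rewrite mulrAC /e' divfK // gt_eqF.
  rewrite /smooth_sum big_distrr /=; apply: ler_sum_nat => d /andP[d0 dD].
  rewrite normrM ger0_norm // mulrCA ler_wpM2l //.
  apply: le_trans (hN0 _ _) _.
    by rewrite leq_divRL //; clear -NN d0 dD; nia.
  by rewrite -[leRHS]mulrA ler_wpM2l ?natr_divn_le // ltW.
apply: le_trans (ler_norm_sum _ _ _) _.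
apply: le_trans (_ : N%:R * (smooth_sum R Q N - smooth_sum R Q D) <= _); last first.
  by rewrite mulrC ler_wpM2r.
have -> : smooth_sum R Q N - smooth_sum R Q D =
    \sum_(D.+1 <= d < N.+1) (Psmooth Q d)%:R / d%:R.
  by rewrite /smooth_sum (@big_cat_nat _ _ _ D.+1 1 N.+1) //= addrAC subrr add0r.
rewrite big_distrr /=; apply: ler_sum_nat => d /andP[Dd _].
rewrite normrM ger0_norm // mulrCA ler_wpM2l //.
apply: le_trans (mertens_le R _) _; apply: natr_divn_le; exact: leq_ltn_trans Dd.
Qed.

Lemma abel_bound (c h : nat -> R) (B : R) N :
  (forall n, (n <= N)%N -> `|\sum_(1 <= k < n.+1) c k| <= B) ->
  (forall n, (0 < n)%N -> 0 <= h n.+1 <= h n) ->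
  `|\sum_(1 <= k < N.+1) c k * h k| <= B * h 1%N.
Proof.
move=> cB hh; rewrite abel_sum; apply: le_trans (ler_normD _ _) _.
have -> : B * h 1%N = B * h N.+1 + \sum_(1 <= k < N.+1) B * (h k - h k.+1).
  rewrite -big_distrr -mulrDr /=; congr (_ * _).
  rewrite (eq_bigr (fun k => - (h k.+1 - h k))) => [|k _]; last by rewrite opprB.
  by rewrite sumrN telescope_sumr // opprB addrC subrK.
apply: lerD.
  case: N cB => [|N] cB.
    rewrite big_geq // mul0r normr0 mulr_ge0 ?(le_trans _ (cB 0%N _)) //.
    by have /andP[h1 h2] := hh 1%N isT; exact: le_trans h2.
  have /andP[h1 _] := hh N.+1 isT; rewrite normrM (ger0_norm h1) ler_wpM2r //.
  exact: cB.
apply: le_trans (ler_norm_sum _ _ _) _; apply: ler_sum_nat => k /andP[k0 kN].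
have /andP[_ h2] := hh k k0.
by rewrite normrM (ger0_norm (_ : 0 <= h k - h k.+1)) ?subr_ge0 // ler_wpM2r ?subr_ge0 // cB.
Qed.

(** Up to [a = N %/ K] the fractional parts are at most 1 and contribute at most [N / K]. Beyond
    [a], [N / n] and its floor are both nonincreasing and at most [K], so Abel's inequality uses the
    smallness of the sums of [f]. *)
Lemma axer (f : nat -> R) : (forall n, `|f n| <= 1) ->
  (forall e, 0 < e -> exists N0, forall N, (N0 <= N)%N ->
     `|\sum_(1 <= n < N.+1) f n| <= e * N%:R) ->
  forall e, 0 < e -> exists N0, forall N, (N0 <= N)%N ->
     `|\sum_(1 <= n < N.+1) f n * (N%:R / n%:R - (N %/ n)%:R)| <= e * N%:R.
Proof.
move=> f1 fo e e0.
pose F N := \sum_(1 <= n < N.+1) f n.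
have FN N : `|F N| <= N%:R.
  apply: le_trans (ler_norm_sum _ _ _) _; rewrite -(sum_nat1 R N).
  exact: ler_sum.
pose K := (Num.truncn (2 / e)).+1.
have KR : 2 / e < K%:R by exact: truncnS_gt.
have K0 : (0 < K)%N by [].
clearbody K.
have K0R : (0 : R) < K%:R by rewrite ltr0n.
have eK : 2 <= e * K%:R by rewrite mulrC -ler_pdivrMr // ltW.
(* Two Abel sums of size [2 B K] must fit in [e / 2 * N], so [B K <= e / 8 * N] is wanted; [e'] and
   the threshold on [N] supply half each. *)
pose e' := e / (16 * K%:R).
have e'0 : 0 < e' by rewrite divr_gt0 // mulr_gt0.
have [N1 hN1] := fo e' e'0.
exists (Num.truncn (16 * K%:R * N1%:R / e)).+1 => N NN.
have NC : 16 * K%:R * N1%:R <= e * N%:R.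
  rewrite [leRHS]mulrC -ler_pdivrMr //; apply/ltW/(lt_le_trans (truncnS_gt _)).
  by rewrite ler_nat.
have NR : (0 : R) <= N%:R by [].
pose B := e' * N%:R + N1%:R.
have FB n : (n <= N)%N -> `|F n| <= B.
  move=> nN; have [n1|n1] := leqP N1 n.
    apply: le_trans (hN1 n n1) _; rewrite -[leLHS]addr0 /B; apply: lerD => //.
    by rewrite ler_wpM2l ?ler_nat // ltW.
  apply: le_trans (FN n) _; rewrite -[leLHS]add0r /B; apply: lerD.
    by rewrite mulr_ge0 // ltW.
  by rewrite ler_nat ltnW.
pose a := (N %/ K)%N.
have aN : (a <= N)%N by rewrite leq_div.
pose c n := if (a < n)%N then f n else 0.
have cB n : (n <= N)%N -> `|\sum_(1 <= k < n.+1) c k| <= 2 * B.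
  move=> nN; have [an|na] := leqP a n.
    have -> : \sum_(1 <= k < n.+1) c k = F n - F a.
      rewrite /F (@big_cat_nat _ _ _ a.+1 1 n.+1) //= [in RHS](@big_cat_nat _ _ _ a.+1 1 n.+1) //=.
      rewrite [RHS]addrAC subrr add0r big1_seq ?add0r.
        by apply: eq_big_nat => k /andP[ak _]; rewrite /c ak.
      by move=> k; rewrite mem_index_iota ltnS /c => /andP[_ /andP[_ ka]]; rewrite ltnNge ka.
    apply: le_trans (ler_normB _ _) _.
    by have := FB n nN; have := FB a aN; lra.
  rewrite big1_seq ?normr0.
    by rewrite mulr_ge0 // (le_trans _ (FB 0%N _)).
  move=> k; rewrite mem_index_iota /c => /andP[_ /andP[_ kn]].
  by rewrite ltnNge (leq_trans _ (ltnW na)).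
have m0 n : (0 < maxn n a.+1)%N by rewrite leq_max orbT.
have ms n : (maxn n a.+1 <= maxn n.+1 a.+1)%N by rewrite geq_max !leq_max leqnSn leqnn orbT.
(* Freezing the weights at [a + 1] makes them monotone from 1 on with first value at most [K];
   nothing changes, since [c] vanishes up to [a]. *)
pose h1 n : R := N%:R / (maxn n a.+1)%:R.
pose h2 n : R := (N %/ maxn n a.+1)%:R.
have m1 : maxn 1 a.+1 = a.+1 by apply/maxn_idPr.
have h1K : h1 1%N <= K%:R.
  rewrite /h1 m1 ler_pdivrMr ?ltr0n // -natrM ler_nat ltnW // mulnC.
  exact: ltn_ceil.
have B1 : `|\sum_(1 <= k < N.+1) c k * h1 k| <= 2 * B * K%:R.
  apply: le_trans (abel_bound (h := h1) cB _) _.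
    move=> n n0; rewrite divr_ge0 //= ler_wpM2l // lef_pV2 ?posrE ?ltr0n //.
    by rewrite ler_nat.
  by rewrite ler_wpM2l // (le_trans _ (cB 0%N _)).
have B2 : `|\sum_(1 <= k < N.+1) c k * h2 k| <= 2 * B * K%:R.
  apply: le_trans (abel_bound (h := h2) cB _) _.
    by move=> n n0; rewrite ler0n ler_nat leq_div2l.
  rewrite ler_wpM2l ?(le_trans _ (cB 0%N _)) //.
  by apply: le_trans h1K; apply: natr_divn_le; rewrite m1.
have -> : \sum_(1 <= n < N.+1) f n * (N%:R / n%:R - (N %/ n)%:R) =
   \sum_(1 <= n < a.+1) f n * (N%:R / n%:R - (N %/ n)%:R) +
   (\sum_(1 <= k < N.+1) c k * h1 k - \sum_(1 <= k < N.+1) c k * h2 k).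
  rewrite -sumrB [in LHS](@big_cat_nat _ _ _ a.+1 1 N.+1) //=; congr (_ + _).
  rewrite [RHS](@big_cat_nat _ _ _ a.+1 1 N.+1) //= [X in _ = X + _]big1_seq ?add0r.
    apply: eq_big_nat => k /andP[ak _]; rewrite /c ak /h1 /h2 mulrBr.
    by rewrite (maxn_idPl ak).
  move=> k; rewrite mem_index_iota ltnS /c => /andP[_ /andP[_ ka]].
  by rewrite ltnNge ka /= !mul0r subrr.
have A1 : `|\sum_(1 <= n < a.+1) f n * (N%:R / n%:R - (N %/ n)%:R)| <= e / 2 * N%:R.
  apply: le_trans (ler_norm_sum _ _ _) _.
  apply: le_trans (_ : \sum_(1 <= n < a.+1) 1 <= _).
    apply: ler_sum_nat => n /andP[n0 _]; rewrite normrM mulr_ile1 //.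
    have := natr_divn_le R N n0; have := natr_divn_gt R N n0 => x1 x2.
    by rewrite ler_norml; apply/andP; split; lra.
  rewrite sum_nat1; apply: le_trans (natr_divn_le R N K0) _.
  rewrite ler_pdivrMr // mulrAC; nra.
have BK : B * K%:R <= e / 8 * N%:R.
  have -> : B * K%:R = e / 16 * N%:R + K%:R * N1%:R.
    by rewrite /B /e'; field; rewrite gt_eqF.
  lra.
apply: le_trans (ler_normD _ _) _.
have := ler_normB (\sum_(1 <= k < N.+1) c k * h1 k) (\sum_(1 <= k < N.+1) c k * h2 k).
lra.
Qed.

Lemma mobius_partial_decomp P N : N%:R * mobius_partial R P N =
  sieve_count R P N +
  \sum_(1 <= n < N.+1) mobiusP R P n * (N%:R / n%:R - (N %/ n)%:R).
Proof.
have -> : sieve_count R P N = \sum_(1 <= n < N.+1) mobiusP R P n * (N %/ n)%:R.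
  transitivity (\sum_(1 <= n < N.+1) dconv (mobiusP R P) (fun=> 1) n).
    by apply: eq_big_nat => n /andP[n0 _]; rewrite mobiusP_conv.
  by rewrite sum_dconv; apply: eq_bigr => n _; rewrite sum_nat1.
rewrite -big_split /= /mobius_partial big_mkcond /= big_ltn // /Psmooth /= add0r.
rewrite big_distrr /=; apply: eq_bigr => n _; rewrite /mobiusP /Psmooth.
by case: ifP => _; ring.
Qed.

Lemma mobius_partial_cvg P : (forall p, P p -> prime p) ->
  mobius_partial R P @ \oo --> limn (euler_partial R P).
Proof.
move=> HP; apply/cvgrPdist_le => e e0; set l := limn _.
have e2 : 0 < e / 2 by rewrite divr_gt0.
have f1 n : `|mobiusP R P n| <= 1.
  by rewrite /mobiusP; case: ifP => _; rewrite ?normr0 // mobius_norm_le1.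
have [N1 h1] := axer f1 (mertensP_little_o HP) e2.
have [N2 h2] := sieve_density HP e2.
exists (maxn 1 (maxn N1 N2)) => // N /=; rewrite !geq_max => /and3P[N0 n1 n2].
have NR : (0 : R) < N%:R by rewrite ltr0n.
rewrite -(ler_pM2l NR) -{1}(gtr0_norm NR) -normrM mulrBr mobius_partial_decomp.
have := h1 N n1; have := h2 N n2; rewrite -/l !ler_norml => /andP[a1 a2] /andP[b1 b2].
by apply/andP; split; lra.
Qed.

Lemma recip_partial_cvgyP P :
  (fun N => (recip_partial R P N)%:E) @ \oo --> +oo%E <->
  ~ exists B : R, forall N, recip_partial R P N <= B.
Proof.
split=> [/cvgeryP/cvgryPge h [B hB]|nb].
  have [N _ /(_ N (leqnn N)) /=] := h (B + 1).
  by have := hB N; lra.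
apply/cvgeryP/cvgryPge => A; have [N hN] : exists N, A <= recip_partial R P N.
  apply: contrapT => nA; apply: nb; exists A => N; rewrite leNgt; apply/negP => AN.
  by apply: nA; exists N; exact: ltW.
exists N => // m /= Nm; apply: le_trans hN _; exact: recip_partial_nondec.
Qed.

End Conclusion.

Theorem theorem1p2 (R : realType) (P : pred nat)
  (HP : forall p, P p -> prime p) :
  cvgn (euler_partial R P) /\
  mobius_partial R P @ \oo --> limn (euler_partial R P) /\
  (mobius_partial R P @ \oo --> (0 : R) <->
     (fun N => (recip_partial R P N)%:E) @ \oo --> +oo%E).
Proof.
split; first exact: euler_cvg.
have cv := @mobius_partial_cvg R P HP; split => //.
split=> [cv0|/recip_partial_cvgyP nb]; last first.
  by rewrite -(euler_lim_recip_unbounded HP nb).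
apply/recip_partial_cvgyP => -[B hB].
have := euler_lim_recip_bounded HP hB.
by rewrite (cvg_unique (@Rhausdorff R) cv cv0) ltxx.
Qed.
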